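(* Up to similarity, the number of planar, slim, distributive lattice diagrams of length $h$ is the $h$-th Catalan number $C_h=\frac{1}{h+1}\binom{2h}{h}$.
   Context: All lattices are finite. A lattice $L$ is slim if its set of nonzero join-irreducible elements contains no three-element antichain. Slim lattices are planar, i.e. they have planar (Hasse) diagrams. A diagram is called slim, distributive, etc. if the lattice it represents has that property; the length of a diagram is the length of the lattice it represents (a chain with $h+1$ elements has length $h$). For planar lattice diagrams $D_1,D_2$, a bijection $\varphi\colon D_1\to D_2$ is a similarity map if it is a lattice isomorphism and, for all $x,y,z\in D_1$ with $x\prec y$ and $x\prec z$, $y$ is to the left of $z$ if and only if $\varphi(y)$ is to the left of $\varphi(z)$. $D_1$ and $D_2$ are similar if there is a similarity map $D_1\to D_2$. ''Up to similarity'' means similar diagrams are counted only once. *)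

(* Defs.v *)
From HB Require Import structures.
From mathcomp Require Import all_boot all_order all_algebra.
From mathcomp Require Import reals.

Set Implicit Arguments.
Unset Strict Implicit.
Unset Printing Implicit Defensive.

Import Order.TTheory GRing.Theory Num.Theory.

Local Open Scope order_scope.

Section Lattices.
Variables (d : Order.disp_t) (L : finTBLatticeType d).
Implicit Types (x y z a b : L) (C : {set L}).

Definition covers x y : bool := (x < y) && [forall z, ~~ (x < z < y)].

Definition join_irreducible x : Prop :=
  forall a b, x = a `|` b -> x = a \/ x = b.

Definition nonzero_join_irreducible x : Prop :=
  x <> \bot /\ join_irreducible x.

Definition slim : Prop :=
  ~ exists x y z,
      [/\ nonzero_join_irreducible x, nonzero_join_irreducible y
        & nonzero_join_irreducible z]
      /\ [/\ x >< y, x >< z & y >< z].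

Definition distributive : Prop :=
  right_distributive (@Order.meet d L) (@Order.join d L).

Definition is_chain C : bool := [forall x in C, forall y in C, x >=< y].

Definition length : nat := (\max_(C : {set L} | is_chain C) #|C|.-1)%N.

End Lattices.

Local Open Scope ring_scope.

Definition on_segment (R : realType) (a b p : R * R) : Prop :=
  exists t : R, [/\ 0 <= t <= 1, p.1 = (1 - t) * a.1 + t * b.1
                  & p.2 = (1 - t) * a.2 + t * b.2].

(* A vertex cannot lie in the interior of an edge of which it is not an end:
   in a lattice with an edge every element is an end of some edge, so
   [edges_noncrossing] already excludes this. *)
Record diagram (R : realType) := Diagram {
  diagram_disp : Order.disp_t;
  lat :> finTBLatticeType diagram_disp;
  pos : lat -> R * R;
  pos_inj : injective pos;
  pos_up : forall x y : lat, (x < y)%O -> (pos x).2 < (pos y).2;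
  edges_noncrossing : forall x y x' y' : lat,
    covers x y -> covers x' y' -> (x, y) <> (x', y') ->
    forall p, on_segment (pos x) (pos y) p ->
      on_segment (pos x') (pos y') p ->
      exists v, [/\ v \in [:: x; y], v \in [:: x'; y'] & p = pos v]
}.

Section Similarity.
Variable R : realType.
Implicit Types D E : diagram R.

(* The horizontal displacement per unit of height, which (unlike the slope)
   is finite on edges and increases from left to right. *)
Definition inv_slope D (x y : D) : R :=
  ((pos y).1 - (pos x).1) / ((pos y).2 - (pos x).2).

(* For y and z covering x: y is to the left of z. *)
Definition left_of D (x y z : D) : Prop := inv_slope x y < inv_slope x z.

Definition similarity_map D E (f : D -> E) : Prop :=
  [/\ bijective f, Order.meet_morphism f, Order.join_morphism f
    & forall x y z : D, covers x y -> covers x z ->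
        left_of x y z <-> left_of (f x) (f y) (f z)].

Definition similar_diagrams D E : Prop := exists f : D -> E, similarity_map f.

Lemma similarity_covers D E (f : D -> E) (x y : D) :
  bijective f -> Order.meet_morphism f -> covers (f x) (f y) = covers x y.
Proof.
move=> [g fK gK] fI.
have f_le (a b : D) : (f a <= f b)%O = (a <= b)%O.
  by rewrite !leEmeet -fI (can_eq fK).
have f_lt (a b : D) : (f a < f b)%O = (a < b)%O.
  by rewrite !lt_leAnge !f_le.
rewrite /covers f_lt; congr andb; apply/forallP/forallP => H z.
  by have := H (f z); rewrite !f_lt.
by have := H (g z); rewrite -(f_lt x) -(f_lt _ y) gK.
Qed.

Lemma similar_diagrams_refl D : similar_diagrams D D.
Proof. by exists id; split=> //; exists id. Qed.

Lemma similar_diagrams_sym D E : similar_diagrams D E -> similar_diagrams E D.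
Proof.
move=> [f [bf fI fU fl]]; have [g fK gK] := bf; exists g; split.
- by exists f.
- by move=> x y; apply: (can_inj fK); rewrite fI !gK.
- by move=> x y; apply: (can_inj fK); rewrite fU !gK.
- move=> x y z; rewrite -{1}(gK x) -{1}(gK y) similarity_covers // => xy.
  rewrite -{1}(gK x) -{1}(gK z) similarity_covers // => xz.
  by have := fl _ _ _ xy xz; rewrite !gK => -[? ?]; split.
Qed.

Lemma similar_diagrams_trans D E F :
  similar_diagrams D E -> similar_diagrams E F -> similar_diagrams D F.
Proof.
move=> [f [bf fI fU fl]] [g [bg gI gU gl]]; exists (g \o f); split.
- exact: bij_comp.
- by move=> x y /=; rewrite fI gI.
- by move=> x y /=; rewrite fU gU.
- move=> x y z xy xz; apply: (iff_trans (fl _ _ _ xy xz)).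
  by apply: gl; rewrite similarity_covers.
Qed.

Definition slim_distributive_of_length (h : nat) D : Prop :=
  [/\ slim D, distributive D & length D = h].

End Similarity.

(* There are exactly n classes of the equivalence relation e on T that meet P;
   the class of x is the predicate e x.  The type of diagrams lives in too
   large a universe for the cardinality theory of classical_sets to apply. *)
Definition number_of_classes (T : Type) (e : T -> T -> Prop) (P : T -> Prop)
    (n : nat) : Prop :=
  exists f : 'I_n -> T -> Prop,
    injective f /\
    forall C : T -> Prop,
      (exists i, C = f i) <-> (exists x, P x /\ C = e x).

Definition catalan (h : nat) : nat := 'C(2 * h, h) %/ h.+1.

Lemma catalan_exact (h : nat) : (catalan h * h.+1 = 'C(2 * h, h))%N.
Proof.
apply: divnK; rewrite -(@Gauss_dvdr _ h) ?coprimeSn //.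
by rewrite -{2}(addnK h h) addnn -mul2n -mul_bin_left dvdn_mulr.
Qed.

(* Main.v *)
From HB Require Import structures.
Require Import Defs.
From mathcomp Require Import all_boot all_order all_algebra.
From mathcomp Require Import reals boolp.
From mathcomp Require Import zify ring lra.

(* Let J be the set of join-irreducibles of a slim distributive lattice L.  Two
   incomparable p, q in J can both be added to exactly one x in L, and the two
   covers of x obtained in this way determine which of p, q is to the left.
   If q, r are incomparable to p then p is on the same side of both: otherwise,
   for q covered by r in J, the 2 x 3 grid spanned by p, q, r would be drawn with
   a twist, and two edges would cross.  Call p in J right if something is to its
   left, and left otherwise.  Left elements form a chain, right elements form a
   chain, and mapping x to (number of left elements below x, number of right
   elements below x) embeds L in the grid N x N; the image is the region between
   two lattice paths, at which common steps are right steps only where the two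
   paths are apart.  Such pairs of paths with h steps are, reading the two paths
   in parallel, the Dyck words of length 2h.  Conversely every such region is a
   lattice drawn without crossings by rotating the grid, and an induction on the
   rank recovers the region from the similarity class. *)

Set Implicit Arguments.
Unset Strict Implicit.
Unset Printing Implicit Defensive.

Import Order.TTheory GRing.Theory Num.Theory.

(** * Pairs of lattice paths and their number *)

(* A word records, step by step, whether the left and the right boundary chain
   of the diagram turn left.  It is a Dyck word of semilength [size w] cut into
   pairs of letters, the second letter of each pair being negated; in [good e w],
   half the current height of the Dyck path, e, is the distance between the two
   chains. *)
Notation word := (seq (bool * bool)).

Fixpoint good (e : nat) (w : word) : bool :=
  if w is (u, v) :: w' then (u || (0 < e)) && good (e + u - v) w' else e == 0.

(** If the chains start together, after k steps the left one is at [(lefts w k, k - lefts w k)] and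
    the right one at [(k - rights w k, rights w k)], so that their distance is
    [lefts w k + rights w k - k]. *)
Definition lefts (w : word) k := count (fun uv => uv.1) (take k w).
Definition rights (w : word) k := count (fun uv => ~~ uv.2) (take k w).

Section Words.
Implicit Types (w : word) (e i j k m n : nat).

Lemma lefts0 w : lefts w 0 = 0. Proof. by rewrite /lefts take0. Qed.
Lemma rights0 w : rights w 0 = 0. Proof. by rewrite /rights take0. Qed.

Lemma leftsS w k : k < size w ->
  lefts w k.+1 = lefts w k + (nth (false, false) w k).1.
Proof.
by move=> kw; rewrite /lefts (take_nth (false, false)) // -cats1 count_cat /= addn0.
Qed.

Lemma rightsS w k : k < size w ->
  rights w k.+1 = rights w k + ~~ (nth (false, false) w k).2.
Proof.
by move=> kw; rewrite /rights (take_nth (false, false)) // -cats1 count_cat /= addn0.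
Qed.

Lemma lefts_oversize w k : size w <= k -> lefts w k = lefts w (size w).
Proof. by move=> wk; rewrite /lefts take_oversize // take_size. Qed.

Lemma rights_oversize w k : size w <= k -> rights w k = rights w (size w).
Proof. by move=> wk; rewrite /rights take_oversize // take_size. Qed.

(** The recursion unrolled: its running value is [e + lefts w k + rights w k - k]. The truncated
    subtraction in [good] is exact, because a step from 0 has first letter [true]. *)
Lemma goodP e w : good e w <->
  [/\ forall k, k < size w -> k <= e + lefts w k + rights w k,
      forall k, k < size w -> e + lefts w k + rights w k = k ->
        (nth (false, false) w k).1
    & e + lefts w (size w) + rights w (size w) = size w].
Proof.
elim: w e => [|[u v] w IH] e /=.
  rewrite /lefts /rights /= !addn0; split=> [/eqP->|[_ _ ->]] //.
split.
  move=> /andP[ue /IH[le_k gr_k tot]]; split.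
  - move=> [|k] //; rewrite ltnS => /le_k.
    by rewrite /lefts /rights /=; lia.
  - move=> [|k]; rewrite /lefts /rights /=; first by case: (u) ue => //=; lia.
    move=> kw kE; apply: gr_k => //; move: kE; rewrite /lefts /rights.
    by lia.
  - by move: tot; rewrite /lefts /rights /=; lia.
move=> [le_k gr_k tot].
have ue : u || (0 < e).
  have := gr_k 0 isT; rewrite /lefts /rights /=.
  by case: (posnP e) => [-> /(_ erefl)->//|e0 _]; rewrite orbT.
rewrite ue; apply/IH; split.
- move=> k kw; have := le_k k.+1 kw; rewrite /lefts /rights /=.
  by lia.
- move=> k kw kE; apply: (gr_k k.+1 kw); move: kE; rewrite /lefts /rights /=.
  by lia.
- by move: tot; rewrite /lefts /rights /=; lia.
Qed.

Lemma lefts_lipschitz w k m : k <= m ->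
  lefts w k <= lefts w m <= lefts w k + (m - k).
Proof.
elim: m => [|m IH]; first by rewrite leqn0 => /eqP->; rewrite subnn addn0 leqnn.
rewrite leq_eqVlt => /orP[/eqP->|]; first by rewrite subnn addn0 leqnn.
rewrite ltnS => /[dup] km /IH; have [mw|wm] := ltnP m (size w).
  by rewrite leftsS //; case: (nth _ w m).1; lia.
by rewrite (lefts_oversize (leqW wm)) -(lefts_oversize wm); lia.
Qed.

Lemma rights_lipschitz w k m : k <= m ->
  rights w k <= rights w m <= rights w k + (m - k).
Proof.
elim: m => [|m IH]; first by rewrite leqn0 => /eqP->; rewrite subnn addn0 leqnn.
rewrite leq_eqVlt => /orP[/eqP->|]; first by rewrite subnn addn0 leqnn.
rewrite ltnS => /[dup] km /IH; have [mw|wm] := ltnP m (size w).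
  by rewrite rightsS //; case: (nth _ w m).2; lia.
by rewrite (rights_oversize (leqW wm)) -(rights_oversize wm); lia.
Qed.

Lemma lefts_le_size w k : lefts w k <= lefts w (size w).
Proof.
have [kw|wk] := leqP k (size w); first by case/andP: (lefts_lipschitz w kw).
by rewrite lefts_oversize ?(ltnW wk).
Qed.

Lemma rights_le_size w k : rights w k <= rights w (size w).
Proof.
have [kw|wk] := leqP k (size w); first by case/andP: (rights_lipschitz w kw).
by rewrite rights_oversize ?(ltnW wk).
Qed.

(** On the level [i + j] these are the grid points between the left chain, where the first
    coordinate is largest, and the right chain, where the second is. *)
Definition region w (p : nat * nat) : bool :=
  (p.1 <= lefts w (p.1 + p.2)) && (p.2 <= rights w (p.1 + p.2)).

Lemma region_max w i j i' j' : region w (i, j) -> region w (i', j') ->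
  region w (maxn i i', maxn j j').
Proof.
rewrite /region /= => /andP[h1 h2] /andP[h3 h4].
have h5 := @lefts_lipschitz w (i + j) (maxn i i' + maxn j j').
have h6 := @lefts_lipschitz w (i' + j') (maxn i i' + maxn j j').
have h7 := @rights_lipschitz w (i + j) (maxn i i' + maxn j j').
have h8 := @rights_lipschitz w (i' + j') (maxn i i' + maxn j j').
apply/andP; split.
  by lia.
by lia.
Qed.

(** In the case of minima [i] and [j'], going down from [(i', j')] to the level [i + j'] lowers
    [lefts] by at most [i' - i], and going down from [(i, j)] lowers [rights] by at most
    [j - j']. *)
Lemma region_min w i j i' j' : region w (i, j) -> region w (i', j') ->
  region w (minn i i', minn j j').
Proof.
rewrite /region /= => /andP[h1 h2] /andP[h3 h4].
have h5 := @lefts_lipschitz w (minn i i' + minn j j') (i + j).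
have h6 := @lefts_lipschitz w (minn i i' + minn j j') (i' + j').
have h7 := @rights_lipschitz w (minn i i' + minn j j') (i + j).
have h8 := @rights_lipschitz w (minn i i' + minn j j') (i' + j').
by apply/andP; split; lia.
Qed.

Variable w : word.
Hypothesis gw : good 0 w.

Lemma sum_ge k : k <= size w -> k <= lefts w k + rights w k.
Proof.
have [le_k _ tot] := (goodP 0 w).1 gw; rewrite leq_eqVlt => /orP[/eqP->|/le_k//].
by rewrite -[X in X <= _]tot.
Qed.

Lemma sum_size : lefts w (size w) + rights w (size w) = size w.
Proof. by have [_ _] := (goodP 0 w).1 gw. Qed.

Lemma sum_tight k : k < size w -> lefts w k + rights w k = k ->
  lefts w k.+1 = (lefts w k).+1.
Proof.
have [_ gr _] := (goodP 0 w).1 gw.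
by move=> kw /(gr k kw) uk; rewrite leftsS // uk addn1.
Qed.

Lemma region_le_size i j : region w (i, j) ->
  [/\ i <= lefts w (size w), j <= rights w (size w) & i + j <= size w].
Proof.
move=> /andP[/= ile jle].
have iw := leq_trans ile (lefts_le_size _ _).
have jw := leq_trans jle (rights_le_size _ _).
by split=> //; rewrite -[X in _ <= X]sum_size leq_add.
Qed.

Lemma region_bot : region w (0, 0).
Proof. by []. Qed.

Lemma region_top : region w (lefts w (size w), rights w (size w)).
Proof. by rewrite /region /= sum_size !leqnn. Qed.

(** As the chains do not cross on the next level, at least one of the two unit steps stays between
    them. If only one step remains below [(i', j')], the Lipschitz bounds from the level of that
    point admit it. *)
Lemma region_step i j i' j' : region w (i, j) -> region w (i', j') ->
  i <= i' -> j <= j' -> (i, j) != (i', j') ->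
  (i < i') && region w (i.+1, j) || (j < j') && region w (i, j.+1).
Proof.
move=> rij rij' ii jj ne; have [/= iw jw kw] := region_le_size rij'.
move: rij rij'; rewrite /region /= addSn addnS => /andP[h1 h2] /andP[h3 h4].
have lt_k : i + j < i' + j'.
  by rewrite ltn_neqAle leq_add // andbT; move: ne; rewrite xpair_eqE; lia.
have a1 := @lefts_lipschitz w (i + j) (i + j).+1 (leqnSn _).
have a2 := @rights_lipschitz w (i + j) (i + j).+1 (leqnSn _).
have a3 := @lefts_lipschitz w (i + j).+1 (i' + j') lt_k.
have a4 := @rights_lipschitz w (i + j).+1 (i' + j') lt_k.
have a5 := @sum_ge (i + j).+1 (leq_trans lt_k kw).
by lia.
Qed.

(** A point without a neighbour on either side of its level is where the two chains meet, and there
    [good] makes the common step a left step. This is what later distinguishes a left step from a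
    right one intrinsically. *)
Lemma region_level i j : region w (i, j) -> region w (i, j.+1) ->
  [\/ region w (i.+1, j),
      exists2 j', j = j'.+1 & region w (i.+1, j')
    | exists2 i', i = i'.+1 & region w (i', j.+1)].
Proof.
move=> rij rij1; have [/= _ _ kw] := region_le_size rij1.
move: rij rij1; rewrite /region /= addnS => /andP[h1 h2] /andP[h3 h4].
have b1 := @lefts_lipschitz w 0 (i + j) isT; rewrite lefts0 in b1.
have b2 := @rights_lipschitz w 0 (i + j) isT; rewrite rights0 in b2.
have [il|li] := ltnP i (lefts w (i + j)).
  have [j' jE] : exists j', j = j'.+1 by exists j.-1; lia.
  by constructor 2; exists j' => //; rewrite jE addnS -addSn in h2 il *; lia.
have [jl|lj] := ltnP j (rights w (i + j)).
  have [i' iE] : exists i', i = i'.+1 by exists i.-1; lia.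
  by constructor 3; exists i' => //; rewrite addnS -addSn -iE; lia.
constructor 1; rewrite addSn; have tight := @sum_tight (i + j).
have a2 := @rights_lipschitz w (i + j) (i + j).+1 (leqnSn _).
by lia.
Qed.

End Words.

(** The two chains are recovered as the extreme points of the region on each level, and the
    increments of [lefts] and [rights] are the letters. *)
Lemma region_inj (w w' : word) : good 0 w -> good 0 w' -> size w = size w' ->
  region w =1 region w' -> w = w'.
Proof.
move=> gw gw' sw rw.
have sub v v' : good 0 v -> good 0 v' -> size v = size v' ->
  region v =1 region v' -> forall k, k <= size v ->
  lefts v k <= lefts v' k /\ rights v k <= rights v' k.
  move=> gv gv' sv rv k kv; have vk := sum_ge gv kv.
  have b1 := @lefts_lipschitz v 0 k isT; rewrite lefts0 in b1.
  have b2 := @rights_lipschitz v 0 k isT; rewrite rights0 in b2.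
  split.
    have := rv (lefts v k, k - lefts v k); rewrite /region /= subnKC; last by lia.
    by lia.
  have := rv (k - rights v k, rights v k); rewrite /region /= subnK; last by lia.
  by lia.
have lE k : k <= size w -> lefts w k = lefts w' k.
  by move=> kw; have := sub _ _ gw gw' sw rw k kw;
    have := sub _ _ gw' gw (esym sw) (fsym rw) k; rewrite -sw => /(_ kw); lia.
have rE k : k <= size w -> rights w k = rights w' k.
  by move=> kw; have := sub _ _ gw gw' sw rw k kw;
    have := sub _ _ gw' gw (esym sw) (fsym rw) k; rewrite -sw => /(_ kw); lia.
apply: (@eq_from_nth _ (false, false)) => // k kw.
have := lE k.+1 kw; have := rE k.+1 kw; rewrite !leftsS ?rightsS -?sw //.
rewrite lE ?rE ?(ltnW kw) // => /addnI h1 /addnI h2.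
move: h1 h2; case: (nth _ w k) => [u v]; case: (nth _ w' k) => [u' v'] /=.
by case: u u' v v' => [] [] [] [].
Qed.

(** * Enumerating and counting the words *)

Definition steps e : seq (bool * bool) :=
  [seq uv <- [:: (true, true); (true, false); (false, true); (false, false)]
     | uv.1 || (0 < e)].

Fixpoint words (n e : nat) : seq word :=
  if n is n'.+1 then
    flatten [seq [seq uv :: w | w <- words n' (e + uv.1 - uv.2)]
      | uv : bool * bool <- steps e]
  else if e == 0 then [:: [::]] else [::].

Lemma wordsS n e : words n.+1 e = flatten
  [seq [seq uv :: w | w <- words n (e + uv.1 - uv.2)] | uv : bool * bool <- steps e].
Proof. by []. Qed.

Lemma mem_words n e w : (w \in words n e) = (size w == n) && good e w.
Proof.
elim: n e w => [|n IH] e w; first by case: e w => [|e] [|].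
apply/flattenP/andP => [[s /mapP[uv uvP ->] /mapP[w' w'P ->]]|].
  case: uv uvP w'P => u v; rewrite mem_filter IH => /andP[/= ue _] /andP[sw gw].
  by rewrite eqSS ue.
case: w => [|[u v] w] [] // /eqP[sw] /andP[ue gw].
exists [seq (u, v) :: w' | w' <- words n (e + u - v)].
  apply/mapP; exists (u, v) => //; rewrite mem_filter /= ue.
  by case: u v {ue gw} => [] [].
by apply/mapP; exists w => //; rewrite IH sw eqxx.
Qed.

Lemma uniq_words n e : uniq (words n e).
Proof.
elim: n e => [|n IH] e; first by case: e.
rewrite wordsS; have: uniq (steps e) by apply: filter_uniq.
elim: (steps e) => //= uv s IHs /andP[uvs us]; rewrite cat_uniq IHs // andbT.
rewrite map_inj_uniq ?IH => [|w w' []//]; apply/hasPn => w.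
case/flattenP=> _ /mapP[uv' us' ->] /mapP[w' _ ->].
by apply/mapP => -[w'' _ [uvE _]]; rewrite -uvE us' in uvs.
Qed.

(** The ballot numbers, written without subtraction. Splitting off the first pair of letters leads
    to heights [e - 1], [e] (twice) and [e + 1], which is Pascal's rule applied twice. *)
Lemma size_words n e : size (words n e) + 'C(2 * n, (n + e).+1) = 'C(2 * n, n + e).
Proof.
elim: n e => [|n IH] e; first by case: e => [|e] //; rewrite !bin0n.
have -> : size (words n.+1 e) = size (words n e) + size (words n e.+1) +
    (if e is e'.+1 then size (words n e') + size (words n e) else 0).
  by case: e => [|e]; rewrite /= /steps /= !size_cat !size_map /= ?addn0 ?addn1 ?subn0
    ?subn1 ?addnK /=; lia.
have -> : 2 * n.+1 = (2 * n).+2 by lia.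
rewrite addSn; have h0 := IH e; have := IH e.+1; rewrite addnS => h1.
case: e => [|e] in h0 h1 *; last first.
  by have := IH e; rewrite !addnS in h0 h1 *; rewrite !binS; lia.
(* At height 0 the two steps with first letter [false] are forbidden; the symmetry of the binomial
   coefficients makes up for the missing terms. *)
have : 'C((2 * n).+1, n.+1) = 'C((2 * n).+1, n).
  by rewrite -bin_sub; [congr 'C(_, _); lia | lia].
by rewrite !addn0 in h0 h1 *; rewrite !binS; lia.
Qed.

Lemma size_words_catalan h : size (words h 0) = catalan h.
Proof.
have := size_words h 0; rewrite addn0 => sE; have catE := catalan_exact h.
(* This turns the difference of the two binomials, multiplied by [h.+1], into the central one. *)
have binE := mul_bin_left (2 * h) h.
have hE : 2 * h - h = h by lia.
rewrite hE in binE; apply/eqP; rewrite -(eqn_pmul2r (ltn0Sn h)); apply/eqP; nia.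
Qed.

(** * Ranked and distributive lattices *)

Local Open Scope order_scope.

Lemma covers_lt (d : Order.disp_t) (L : finTBLatticeType d) (x y : L) :
  covers x y -> x < y.
Proof. by case/andP. Qed.

Lemma covers_eq (d : Order.disp_t) (L : finTBLatticeType d) (x y z : L) :
  covers x y -> x < z -> z <= y -> z = y.
Proof.
case/andP=> _ /forallP/(_ z) nz xz; rewrite le_eqVlt => /orP[/eqP //|zy].
by rewrite xz zy in nz.
Qed.

Lemma is_chainP (d : Order.disp_t) (L : finTBLatticeType d) (C : {set L}) :
  reflect {in C &, forall x y, x >=< y} (is_chain C).
Proof.
apply: (iffP forall_inP) => [cC x y xC | cC x xC]; first exact/forall_inP/cC.
by apply/forall_inP=> y; apply: cC.
Qed.

Section Rank.
Variables (d : Order.disp_t) (L : finTBLatticeType d) (rk : L -> nat).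
Hypothesis rk_lt : forall x y, x < y -> (rk x < rk y)%N.
Hypothesis rk_step : forall x y, x < y ->
  exists z, [/\ x < z, z <= y & rk z = (rk x).+1].

Lemma covers_rank x y : covers x y = (x < y) && (rk y == (rk x).+1).
Proof.
apply/idP/andP => [xy | [xy /eqP rkE]].
  split; first exact: covers_lt.
  by have [z [xz zy <-]] := rk_step (covers_lt xy); rewrite (covers_eq xy xz zy).
rewrite /covers xy /=; apply/forallP=> z; apply/negP=> /andP[xz zy].
by have := rk_lt xz; have := rk_lt zy; lia.
Qed.

Lemma rank_le x y : x <= y -> (rk x <= rk y)%N.
Proof. by rewrite le_eqVlt => /orP[/eqP->// | /rk_lt/ltnW]. Qed.

Hypothesis rk_bot : rk \bot = 0%N.

Lemma chain_to_rank k : (k <= rk \top)%N ->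
  exists (C : {set L}) x,
    [/\ is_chain C, x \in C, rk x = k, {in C, forall y, y <= x} & #|C| = k.+1].
Proof.
elim: k => [_ | k IH kt].
  exists [set \bot], \bot; split; rewrite ?set11 ?cards1 //.
    by apply/is_chainP=> a b /set1P-> /set1P->; apply: comparablexx.
  by move=> y /set1P->.
have [C [x [cC xC xk Cx cardC]]] := IH (ltnW kt).
have xt : x < \top.
  by rewrite lt_neqAle lex1 andbT; apply/eqP => xE; rewrite -xE xk ltnn in kt.
have [z [xz _ zk]] := rk_step xt.
have Cz y : y \in C -> y < z by move=> yC; apply: le_lt_trans (Cx _ yC) xz.
exists (z |: C), z; split; first 1 last.
- by rewrite setU11.
- by rewrite zk xk.
- by move=> y /setU1P[->// | /Cz/ltW].
- by rewrite cardsU1 cardC; case: (boolP (z \in C)) => [/Cz|//]; rewrite ltxx.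
apply/is_chainP=> a b /setU1P[->|aC] /setU1P[->|bC].
- exact: comparablexx.
- by rewrite comparable_sym lt_comparable ?Cz.
- by rewrite lt_comparable ?Cz.
- by move/is_chainP: cC; apply.
Qed.

(** The rank is injective on a chain, which bounds its cardinality; unit steps from the bottom give
    a chain that attains the bound. *)
Lemma length_rank : length L = rk \top.
Proof.
apply/eqP; rewrite eqn_leq; apply/andP; split.
  apply/bigmax_leqP => C /is_chainP cC.
  suff: (#|C| <= (rk \top).+1)%N by lia.
  rewrite -[X in (_ <= X)%N]card_ord.
  apply: (@leq_card_in _ _ (fun x : L => inord (rk x) : 'I_(rk \top).+1)) => x y xC yC.
  move=> /(congr1 val); rewrite /= !inordK ?ltnS ?rank_le ?lex1 // => rkE.
  by case: (comparable_ltgtP (cC x y xC yC)) => // /rk_lt; rewrite rkE ltnn.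
have [C [x [cC _ _ _ cardC]]] := chain_to_rank (leqnn _).
by apply: leq_trans (leq_bigmax_cond (F := fun C : {set L} => #|C|.-1) _ cC); rewrite cardC.
Qed.

End Rank.

Local Open Scope order_scope.

(** * Join-irreducible elements and covers in a distributive lattice *)

Section JoinIrreducibles.
Variables (d : Order.disp_t) (L : finTBLatticeType d).
Hypothesis distL : distributive L.
Implicit Types x y z p q r : L.

Definition jirr p : bool :=
  (p != \bot) && [forall a, forall b, (p == a `|` b) ==> (p == a) || (p == b)].

Lemma jirrP p : reflect (nonzero_join_irreducible p) (jirr p).
Proof.
apply: (iffP andP) => [[/eqP p0 /forallP pj] | [/eqP p0 pj]]; split=> //.
  move=> a b pE; have /forallP/(_ b)/implyP := pj a.
  by rewrite -pE eqxx => /(_ isT)/orP[]/eqP; [left | right].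
apply/forallP=> a; apply/forallP=> b; apply/implyP=> /eqP/pj[] <-.
  by rewrite eqxx.
by rewrite eqxx orbT.
Qed.

(** Distributivity makes join-irreducibles join-prime: p is the join of its meets with x and y. *)
Lemma jirr_le_join p x y : jirr p -> (p <= x `|` y) = (p <= x) || (p <= y).
Proof.
move=> /jirrP[_ pj]; apply/idP/orP => [pxy | [px|py]]; last 2 first.
- exact: le_trans px (leUl _ _).
- exact: le_trans py (leUr _ _).
have: p = (p `&` x) `|` (p `&` y) by rewrite -distL; symmetry; apply/meet_idPl.
by case/pj=> ->; [left | right]; apply: leIr.
Qed.

Lemma jirr_le_bigjoin (I : finType) (P : pred I) (F : I -> L) p :
  jirr p -> p <= \join_(i | P i) F i -> exists2 i, P i & p <= F i.
Proof.
move=> pj; elim/big_rec: _ => [|i z Pi IH].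
  by rewrite lex0 => /eqP p0; move: pj; rewrite /jirr p0 eqxx.
by rewrite jirr_le_join // => /orP[pi | /IH//]; exists i.
Qed.

(** Take p minimal among the elements below x but not below y. Were it a join of two smaller
    elements, both would be below y by minimality, and so would p. *)
Lemma jirr_separation x y : ~~ (x <= y) ->
  exists p, [/\ jirr p, p <= x, ~~ (p <= y) & forall z, z < p -> z <= y].
Proof.
move=> xy; pose P z := (z <= x) && ~~ (z <= y).
have Px : P x by rewrite /P lexx.
have [p /andP[px py] minp] : {p | P p & forall z, z < p -> ~~ P z}.
  case: (@arg_minnP _ x P (fun z => #|[set u | u <= z]|) Px) => p Pp minp.
  exists p => // z zp; apply/negP => /minp.
  apply/negP; rewrite -ltnNge; apply/proper_card/properP; split.
    by apply/subsetP=> u; rewrite !inE => /le_trans; apply; apply: ltW.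
  by exists p; rewrite !inE ?lexx // (lt_geF zp).
have lty z : z < p -> z <= y.
  move=> zp; have := minp z zp; rewrite negb_and negbK.
  by rewrite (le_trans (ltW zp) px).
exists p; split=> //; apply/andP; split.
  by apply/eqP => p0; rewrite p0 le0x in py.
apply/forallP=> a; apply/forallP=> b; apply/implyP=> /eqP pE.
apply/negPn/negP; rewrite negb_or => /andP[pa pb].
by case/negP: py; rewrite pE leUx !lty // lt_neqAle eq_sym ?pa ?pb pE ?leUl ?leUr.
Qed.

(** Birkhoff's representation of x by a down-set of join-irreducibles; its cardinality will be the
    rank of x. *)
Definition below x : {set L} := [set p | jirr p & p <= x].

Lemma in_below x p : (p \in below x) = jirr p && (p <= x).
Proof. by rewrite inE. Qed.

Lemma le_below x y : (x <= y) = (below x \subset below y).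
Proof.
apply/idP/subsetP => [xy p | sxy].
  by rewrite !inE => /andP[-> /le_trans->].
apply: contraT => /jirr_separation[p [pj px py _]].
by have := sxy p; rewrite !inE pj px (negPf py) => /(_ isT).
Qed.

Lemma below_inj : injective below.
Proof. by move=> x y xy; apply/le_anti; rewrite !le_below xy subxx. Qed.

Lemma below_join x y : below (x `|` y) = below x :|: below y.
Proof.
by apply/setP=> p; rewrite !inE; case: (boolP (jirr p)) => // /jirr_le_join->.
Qed.

Lemma below_meet x y : below (x `&` y) = below x :&: below y.
Proof. by apply/setP=> p; rewrite !inE lexI; case: (jirr p). Qed.

Lemma below_bot : below \bot = set0.
Proof.
apply/setP=> p; rewrite !inE lex0.
by apply/negP => /andP[/andP[/negP]].
Qed.

(** p is minimal among the join-irreducibles outside [below x], so adding it gives again a down-set;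
    the covers of x arise in this way. *)
Definition addable x p : Prop :=
  [/\ jirr p, ~~ (p <= x) & forall q, jirr q -> q < p -> q <= x].

Lemma below_add x p : addable x p -> below (x `|` p) = p |: below x.
Proof.
move=> [pj _ px]; rewrite below_join setUC; apply/setP=> q; rewrite !inE.
case: (boolP (jirr q)) => qj /=; last by case: eqP => // qp; rewrite qp pj in qj.
rewrite le_eqVlt -orbA; case: (boolP (q < p)) => // /(px q qj) ->.
by rewrite !orbT.
Qed.

Lemma card_below_add x p : addable x p -> #|below (x `|` p)| = #|below x|.+1.
Proof.
move=> pa; rewrite below_add // cardsU1; case: pa => pj px _.
by rewrite inE pj (negPf px).
Qed.

Lemma card_below_lt x y : x < y -> (#|below x| < #|below y|)%N.
Proof.
by rewrite lt_leAnge !le_below => xy; apply: proper_card; rewrite properE.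
Qed.

Lemma lt_addable x y : x < y -> exists2 p, addable x p & p <= y.
Proof.
rewrite lt_leAnge => /andP[_] /jirr_separation[p [pj py px minp]].
by exists p => //; split=> // q _; apply: minp.
Qed.

Lemma card_below_step x y : x < y ->
  exists z, [/\ x < z, z <= y & #|below z| = #|below x|.+1].
Proof.
move=> xy; have [p pa py] := lt_addable xy; exists (x `|` p); split.
- by rewrite lt_leAnge leUl leUx lexx; case: pa.
- by rewrite leUx (ltW xy).
- exact: card_below_add.
Qed.

Lemma covers_card_below x y :
  covers x y = (x < y) && (#|below y| == #|below x|.+1).
Proof. exact: (covers_rank (rk := fun z => #|below z|) card_below_lt card_below_step). Qed.

Lemma covers_add x p : addable x p -> covers x (x `|` p).
Proof.
move=> pa; rewrite covers_card_below card_below_add // eqxx andbT.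
by rewrite lt_leAnge leUl leUx lexx; case: pa.
Qed.

Lemma covers_addable x y : covers x y -> exists2 p, addable x p & y = x `|` p.
Proof.
move=> xy; have [p pa py] := lt_addable (covers_lt xy); exists p => //.
apply/esym/(covers_eq xy); last by rewrite leUx (ltW (covers_lt xy)).
exact/covers_lt/covers_add.
Qed.

Lemma length_card_below : length L = #|below \top|.
Proof.
apply: (length_rank (rk := fun z => #|below z|) card_below_lt card_below_step).
by rewrite below_bot cards0.
Qed.

Lemma addable_incomparable x p q :
  addable x p -> addable x q -> p != q -> p >< q.
Proof.
move=> [pj px ltp] [qj qx ltq] /eqP pq; case: (comparableP p q) => //.
  by move=> /(ltq p pj); rewrite (negPf px).
by move=> /(ltp q qj); rewrite (negPf qx).
Qed.

Lemma addable_joinr x p q :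
  addable x p -> addable x q -> p != q -> addable (x `|` p) q.
Proof.
move=> pa qa pq; have pIq := addable_incomparable pa qa pq.
move: pa qa => [pj px ltp] [qj qx ltq]; split=> //.
  rewrite jirr_le_join // (negPf qx) /=; apply: contra pIq => qp.
  by rewrite ge_comparable.
by move=> r rj rq; apply: le_trans (ltq r rj rq) (leUl _ _).
Qed.

Hypothesis slimL : slim L.

Lemma slim_comparable p q r : jirr p -> jirr q -> jirr r ->
  [|| p >=< q, p >=< r | q >=< r].
Proof.
move=> /jirrP pj /jirrP qj /jirrP rj; apply/negPn/negP; rewrite (negb_or (p >=< q)) (negb_or (p >=< r)).
by case/and3P=> *; apply: slimL; exists p, q, r; split; split.
Qed.

(** The witness is the join of all elements strictly below p or strictly below q; p and q are not
    below it, being join-prime and incomparable. *)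
Lemma incomparable_addable p q : jirr p -> jirr q -> p >< q ->
  exists2 x, addable x p & addable x q.
Proof.
move=> pj qj pq; pose P r := [|| r < p | r < q].
have Pnot r : P r -> r <= \join_(s | P s) s.
  by move=> Pr; apply: joins_sup.
exists (\join_(s | P s) s); split=> //.
- apply/negP => /(jirr_le_bigjoin pj)[s /orP[sp|sq] ps].
    by have := le_lt_trans ps sp; rewrite ltxx.
  by case/negP: pq; apply: lt_comparable; apply: le_lt_trans ps sq.
- by move=> r rj rp; apply: Pnot; rewrite /P rp.
- apply/negP => /(jirr_le_bigjoin qj)[s /orP[sp|sq] qs].
    by case/negP: pq; apply: gt_comparable; apply: le_lt_trans qs sp.
  by have := le_lt_trans qs sq; rewrite ltxx.
- by move=> r rj rq; apply: Pnot; rewrite /P rq orbT.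
Qed.

(** By slimness every join-irreducible is comparable to p or to q. One that lies below x cannot be
    above either, so it is strictly below one of them and hence below y. *)
Lemma addable_pair_inj x y p q : p != q ->
  addable x p -> addable x q -> addable y p -> addable y q -> x = y.
Proof.
move=> pq; suff sub u v : addable u p -> addable u q ->
    addable v p -> addable v q -> below u \subset below v.
  move=> xp xq yp yq; apply: below_inj.
  by apply/eqP; rewrite eqEsubset !sub.
move=> up uq vp vq; have := addable_incomparable up uq pq.
move: up uq vp vq => [pj pu _] [qj qu _] [_ _ pv] [_ _ qv] pIq.
apply/subsetP=> r; rewrite !inE => /andP[rj ru]; rewrite rj /=.
have := slim_comparable rj pj qj; rewrite (negPf pIq) orbF.
case/orP; case: comparableP => // [rp|pr|rE] _.
- exact: pv.
- by case/negP: pu; apply: le_trans (ltW pr) ru.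
- by case/negP: pu; rewrite -rE.
- exact: qv.
- by case/negP: qu; apply: le_trans (ltW pr) ru.
- by case/negP: qu; rewrite -rE.
Qed.

(** A join-irreducible s strictly below r and not below q is incomparable to q, as r covers q among
    the join-irreducibles. Slimness then makes s comparable to p, and only [s < p] is compatible
    with p and r being incomparable. *)
Lemma addable_upper x p q r :
  addable x p -> addable x q -> jirr r -> p >< r -> q < r ->
  (forall s, jirr s -> q < s -> ~~ (s < r)) ->
  addable (x `|` q) r.
Proof.
move=> [pj px ltp] [qj qx ltq] rj pr qr cov; split=> //.
  rewrite jirr_le_join // negb_or (lt_geF qr) andbT.
  by apply: contra qx; apply/le_trans/ltW.
move=> s sj sr; rewrite jirr_le_join //.
have pq : p >< q.
  apply: (@addable_incomparable x) => //.
  by apply/eqP => pq; case/negP: pr; rewrite pq lt_comparable.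
case: (comparableP s q) => [sq|qs|sIq|->]; rewrite ?lexx ?orbT //.
  by have := cov s sj qs; rewrite sr.
have := slim_comparable sj pj qj; rewrite (negPf sIq) (negPf pq) !orbF.
case: comparableP => // [sp|ps|sE] _.
- by rewrite ltp.
- by case/negP: pr; rewrite lt_comparable // (lt_trans ps sr).
- by case/negP: pr; rewrite -sE lt_comparable.
Qed.

End JoinIrreducibles.

(** * Polygonal paths in the plane and edges of a diagram *)

Local Open Scope ring_scope.

Section PlanePaths.
Variable R : realType.
Implicit Types (a b c e : R * R) (f g : R -> R) (s t u : R).

Definition slope_of a b : R := (b.1 - a.1) / (b.2 - a.2).

(** Edges rise strictly, so they are treated as functions of the height; being to the left then
    means having the smaller value. *)
Definition line a b t : R := a.1 + slope_of a b * (t - a.2).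

Lemma line_left a b : line a b a.2 = a.1.
Proof. by rewrite /line subrr mulr0 addr0. Qed.

Lemma line_right a b : a.2 < b.2 -> line a b b.2 = b.1.
Proof.
by move=> ab; rewrite /line /slope_of mulfVK ?subr_eq0 ?gt_eqF //; ring.
Qed.

Lemma line_on_segment a b t :
  a.2 < b.2 -> a.2 <= t <= b.2 -> on_segment a b (line a b t, t).
Proof.
move=> ab /andP[at_ tb]; have ab0 : 0 < b.2 - a.2 by rewrite subr_gt0.
exists ((t - a.2) / (b.2 - a.2)); split=> /=.
- by apply/andP; split; [apply: divr_ge0; lra | rewrite ler_pdivrMr //; lra].
- by rewrite /line /slope_of; field; rewrite gt_eqF.
- by field; rewrite gt_eqF.
Qed.

Definition stays_left f g s t : Prop :=
  forall u v, s <= u -> u <= v -> v <= t -> f u < g u -> f v < g v.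

Definition apart a b c e : Prop :=
  forall u, a.2 <= u <= b.2 -> c.2 <= u <= e.2 -> line a b u <> line c e u.

Lemma stays_left_line a b c e s t :
  a.2 <= s -> t <= b.2 -> c.2 <= s -> t <= e.2 -> apart a b c e ->
  stays_left (line a b) (line c e) s t.
Proof.
move=> as_ tb cs te ap u v su uv vt ltu; rewrite ltNge; apply/negP => gev.
pose w x := line c e x - line a b x.
have wu : 0 < w u by rewrite subr_gt0.
have wv : w v <= 0 by rewrite subr_le0.
have wuv : 0 < w u - w v by lra.
(* the zero of the affine function w between u and v *)
pose x := u + (v - u) * (w u / (w u - w v)).
have r01 : 0 <= w u / (w u - w v) <= 1.
  by apply/andP; split; [apply: divr_ge0; lra | rewrite ler_pdivrMr //; lra].
have [ux xv] : u <= x /\ x <= v.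
  by move/andP: r01 => [r0 r1]; rewrite /x; split; nra.
case: (ap x); try by apply/andP; split; lra.
apply/esym/eqP; rewrite -subr_eq0 -/(w x); apply/eqP.
have wE z : w z = w u + (slope_of c e - slope_of a b) * (z - u).
  by rewrite /w /line; ring.
have wvE : (slope_of c e - slope_of a b) * (v - u) = w v - w u.
  by rewrite (wE v); ring.
rewrite wE /x; have -> : u + (v - u) * (w u / (w u - w v)) - u =
  (v - u) * (w u / (w u - w v)) by ring.
by rewrite mulrA wvE; field; rewrite gt_eqF.
Qed.

Definition bend a b c t : R := if t <= b.2 then line a b t else line b c t.

Lemma bend_low a b c t : t <= b.2 -> bend a b c t = line a b t.
Proof. by rewrite /bend => ->. Qed.

Lemma bend_high a b c t : a.2 < b.2 -> b.2 <= t -> bend a b c t = line b c t.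
Proof.
rewrite /bend => ab bt; case: ifP => // tb.
have -> : t = b.2 by apply/le_anti; rewrite tb.
by rewrite line_right // line_left.
Qed.

(** The two lines agree at the height of b, so an inequality can be carried up to b along the first
    and onwards along the second. *)
Lemma stays_left_bendl a b c g s t : a.2 < b.2 ->
  stays_left (line a b) g s (Num.min t b.2) ->
  stays_left (line b c) g (Num.max s b.2) t ->
  stays_left (bend a b c) g s t.
Proof.
move=> ab low high u v su uv vt.
have [vb | bv] := lerP v b.2.
  by rewrite !bend_low ?(le_trans uv) //; apply: low; rewrite ?le_min ?vt.
rewrite [bend _ _ _ v]bend_high ?(ltW bv) //; have [ub | bu] := lerP u b.2.
  rewrite bend_low // => /(low u b.2)lt_b.
  apply: (high b.2 v) => //; [by rewrite ge_max (le_trans su) /= | exact: ltW |].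
  rewrite line_left -(line_right ab); apply: lt_b => //.
  by rewrite le_min lexx (le_trans (ltW bv)).
by rewrite bend_high ?(ltW bu) //; apply: high; rewrite // ge_max su ltW.
Qed.

Lemma stays_left_bendr a b c g s t : a.2 < b.2 ->
  stays_left g (line a b) s (Num.min t b.2) ->
  stays_left g (line b c) (Num.max s b.2) t ->
  stays_left g (bend a b c) s t.
Proof.
move=> ab low high u v su uv vt.
have [vb | bv] := lerP v b.2.
  by rewrite !bend_low ?(le_trans uv) //; apply: low; rewrite ?le_min ?vt.
rewrite [bend _ _ _ v]bend_high ?(ltW bv) //; have [ub | bu] := lerP u b.2.
  rewrite bend_low // => /(low u b.2)lt_b.
  apply: (high b.2 v) => //; [by rewrite ge_max (le_trans su) /= | exact: ltW |].
  rewrite line_left -(line_right ab); apply: lt_b => //.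
  by rewrite le_min lexx (le_trans (ltW bv)).
by rewrite bend_high ?(ltW bu) //; apply: high; rewrite // ge_max su ltW.
Qed.

(** Just above their common start the smaller slope puts a-b to the left of a-e, and this lasts as
    long as a-b does; afterwards b-c cannot cross a-e. *)
Lemma bend_left_of_edge a b c e :
  a.2 < b.2 -> b.2 < c.2 -> a.2 < e.2 -> e.2 <= c.2 ->
  apart b c a e -> slope_of a b < slope_of a e -> bend a b c e.2 < e.1.
Proof.
move=> ab bc ae ec ap sl.
have near u : a.2 < u -> line a b u < line a e u.
  by move=> au; rewrite /line ltrD2l ltr_pM2r ?subr_gt0.
rewrite -[X in _ < X](line_right ae); have [eb | be] := lerP e.2 b.2.
  by rewrite bend_low // near.
rewrite bend_high ?(ltW be) //.
apply: (stays_left_line (lexx _) ec (ltW ab) (lexx _) ap (lexx _) (ltW be) (lexx _)).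
by rewrite line_left -(line_right ab) near.
Qed.

(* The path a-e-h starts inside the quadrangle x p c a and ends above c, so it
   would have to cross one of the quadrangle's sides. *)
Lemma no_left_twist (x a p c e h : R * R) :
  [/\ x.2 < p.2, x.2 < a.2 & p.2 < c.2] ->
  [/\ a.2 < c.2, a.2 < e.2, e.2 < h.2 & c.2 < h.2] ->
  [/\ apart p c x a, apart e h a c, apart x p a e & apart x p e h] ->
  apart p c a e -> apart p c e h ->
  slope_of x p < slope_of x a -> slope_of a e < slope_of a c -> False.
Proof.
move=> [xp xa pc] [ac ae eh ch] [pcxa ehac xpae xpeh] pcae pceh sx sa.
have pa : bend x p c a.2 < a.1 by apply: bend_left_of_edge => //; apply: ltW.
have ec : bend a e h c.2 < c.1 by apply: bend_left_of_edge => //; apply: ltW.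
(* At the height of c the path x-p-c is at c itself, so c would be to the left of the path a-e-h,
   contrary to [ec]. *)
have: stays_left (bend x p c) (bend a e h) a.2 c.2.
  by apply: stays_left_bendl => //; apply: stays_left_bendr => //;
    apply: stays_left_line => //;
    rewrite ?(ge_min, le_max, lexx, orbT, (ltW xa), (ltW ch)).
move/(_ a.2 c.2 (lexx _) (ltW ac) (lexx _)).
rewrite [bend a e h _]bend_low ?(ltW ae) // line_left => /(_ pa).
by rewrite [bend x p c _]bend_high ?(ltW pc) // line_right // => /(lt_trans ec); rewrite ltxx.
Qed.

Definition mirror a : R * R := (- a.1, a.2).

Lemma slope_of_mirror a b : slope_of (mirror a) (mirror b) = - slope_of a b.
Proof. by rewrite /slope_of /= -mulNr opprB opprK addrC. Qed.

Lemma apart_mirror a b c e :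
  apart a b c e -> apart (mirror a) (mirror b) (mirror c) (mirror e).
Proof.
move=> ap u abu ceu; have := ap u abu ceu.
by rewrite /line !slope_of_mirror /= => ne eq; apply: ne; lra.
Qed.

(** Reflection in the vertical axis negates the slopes and reduces this to the left case. *)
Lemma no_right_twist (x a p c e h : R * R) :
  [/\ x.2 < p.2, x.2 < a.2 & p.2 < c.2] ->
  [/\ a.2 < c.2, a.2 < e.2, e.2 < h.2 & c.2 < h.2] ->
  [/\ apart p c x a, apart e h a c, apart x p a e & apart x p e h] ->
  apart p c a e -> apart p c e h ->
  slope_of x a < slope_of x p -> slope_of a c < slope_of a e -> False.
Proof.
move=> hyp1 hyp2 [a1 a2 a3 a4] a5 a6 sx sa.
apply: (@no_left_twist (mirror x) (mirror a) (mirror p) (mirror c) (mirror e)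
  (mirror h)); rewrite ?slope_of_mirror ?ltrN2 //; try exact: apart_mirror.
by split; apply: apart_mirror.
Qed.

End PlanePaths.

(** * Edges of a diagram as segments that do not cross *)

Section DiagramEdges.
Variables (R : realType) (D : diagram R).
Implicit Types x y z : D.

Lemma inv_slopeE x y : inv_slope x y = slope_of (pos x) (pos y).
Proof. by []. Qed.

Lemma covers_pos x y : covers x y -> (pos x).2 < (pos y).2.
Proof. by case/andP=> /pos_up. Qed.

Lemma edges_apart x y x' y' : covers x y -> covers x' y' ->
  x != x' -> x != y' -> y != x' -> y != y' ->
  apart (pos x) (pos y) (pos x') (pos y').
Proof.
move=> xy xy' n1 n2 n3 n4 t tx tx' lE.
have ne : (x, y) <> (x', y') by case=> xE; rewrite xE eqxx in n1.
have [||v] := edges_noncrossing xy xy' ne (p := (line (pos x) (pos y) t, t)).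
- exact/line_on_segment/tx/covers_pos.
- by rewrite lE; apply/line_on_segment/tx'/covers_pos.
rewrite !inE => -[/orP[]/eqP-> /orP[]/eqP vE _];
  by rewrite vE eqxx in n1 n2 n3 n4.
Qed.

(** With equal slopes, the lower of y and z would lie on the edge to the other one and so be an end
    of it. *)
Lemma inv_slope_inj x y z :
  covers x y -> covers x z -> inv_slope x y = inv_slope x z -> y = z.
Proof.
wlog yz : y z / (pos y).2 <= (pos z).2.
  move=> H xy xz sE; have [yz | /ltW zy] := lerP (pos y).2 (pos z).2; first exact: H.
  by apply/esym/H.
move=> xy xz sE; have [//|/eqP nyz] := eqVneq y z.
have ne : (x, y) <> (x, z) by case.
have xy2 := covers_pos xy; have xz2 := covers_pos xz.
have yE : line (pos x) (pos z) (pos y).2 = line (pos x) (pos y) (pos y).2.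
  by rewrite /line -!inv_slopeE sE.
have [||v] := edges_noncrossing xy xz ne
  (p := (line (pos x) (pos y) (pos y).2, (pos y).2)).
- by apply: line_on_segment => //; rewrite lexx ltW.
- by rewrite -yE; apply: line_on_segment => //; rewrite yz ltW.
rewrite line_right // -surjective_pairing => -[_ vxz /pos_inj yv].
move: vxz; rewrite -yv !inE => /orP[]/eqP; last by [].
by move=> yx; rewrite yx ltxx in xy2.
Qed.

Lemma left_of_total x y z :
  covers x y -> covers x z -> y != z -> left_of x y z \/ left_of x z y.
Proof.
move=> xy xz yz; have : inv_slope x y != inv_slope x z.
  by apply: contra yz => /eqP/(inv_slope_inj xy xz)->.
by rewrite neq_lt => /orP.
Qed.

Lemma left_of_asym x y z : left_of x y z -> ~ left_of x z y.
Proof. by rewrite /left_of => yz zy; have := lt_trans yz zy; rewrite ltxx. Qed.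

End DiagramEdges.

(** * Left and right join-irreducibles *)

Local Open Scope order_scope.

Section Orientation.
Variables (R : realType) (D : diagram R).
Hypotheses (distD : distributive D) (slimD : slim D).
Implicit Types x y z p q r s : D.

(* By [addable_pair_inj], such an x is unique. *)
Definition jleft p q : Prop :=
  exists x, [/\ addable x p, addable x q & left_of x (x `|` p) (x `|` q)].

Lemma add_neq x p q : addable x p -> addable x q -> p != q ->
  x `|` p != x `|` q.
Proof.
move=> pa qa pq; have [qj pxq _] := addable_joinr distD pa qa pq.
by apply/eqP => E; rewrite E leUr in pxq.
Qed.

Lemma jleftE x p q : addable x p -> addable x q -> p != q ->
  jleft p q <-> left_of x (x `|` p) (x `|` q).
Proof.
move=> pa qa pq; split=> [[y [pya qya ]]|]; last by exists x.
by rewrite (addable_pair_inj slimD pq pa qa pya qya).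
Qed.

Lemma jleft_total p q : jirr p -> jirr q -> p >< q -> jleft p q \/ jleft q p.
Proof.
move=> pj qj pq; have [x pa qa] := incomparable_addable distD pj qj pq.
have npq : p != q by apply/eqP => E; rewrite E comparablexx in pq.
have := left_of_total (covers_add distD pa) (covers_add distD qa) (add_neq pa qa npq).
by case=> lx; [left | right]; exists x.
Qed.

Lemma jleft_asym p q : jleft p q -> ~ jleft q p.
Proof.
move=> [x [pa qa lx]] qp.
have pq : p != q by apply/eqP => E; move: lx; rewrite E /left_of ltxx.
by move/(jleftE qa pa): qp; rewrite eq_sym => /(_ pq); apply: left_of_asym lx.
Qed.

(** The grid has a side x, a, e without p and a side b, c, h with p, where a and e add q and then r.
    If the edge adding p changed sides between x and a, the drawing would be twisted as excluded in
    the plane. *)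
Lemma twist_free x p q r : addable x p -> addable x q -> addable (x `|` q) r ->
  p != q -> p != r ->
  ~ (left_of x (x `|` p) (x `|` q) /\
     left_of (x `|` q) (x `|` q `|` r) (x `|` q `|` p)) /\
  ~ (left_of x (x `|` q) (x `|` p) /\
     left_of (x `|` q) (x `|` q `|` p) (x `|` q `|` r)).
Proof.
move=> xp xq ar pq pr; have qp : q != p by rewrite eq_sym.
have rp : r != p by rewrite eq_sym.
have ap : addable (x `|` q) p by apply: addable_joinr.
have pq' : addable (x `|` p) q by apply: addable_joinr.
have bp : addable (x `|` q `|` r) p by apply: addable_joinr.
have cr : addable (x `|` q `|` p) r by apply: addable_joinr.
set a := x `|` q in ap bp cr ar *; set b := x `|` p in pq' *.
set c := a `|` p in cr *; set e := a `|` r in bp *.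
pose h := e `|` p.
have cE : c = b `|` q by rewrite /c /b /a joinAC.
have hE : h = c `|` r by rewrite /h /e /c joinAC.
have xb : covers x b by apply: covers_add.
have xa : covers x a by apply: covers_add.
have bc : covers b c by rewrite cE; apply: covers_add.
have ac : covers a c by apply: covers_add.
have ae : covers a e by apply: covers_add.
have eh : covers e h by apply: covers_add.
have ch : covers c h by rewrite hE; apply: covers_add.
have pb : p <= b := leUr _ _.
have pc : p <= c := leUr _ _.
have [_ pe _] := bp; have [_ pa _] := ap.
(* Vertices above p differ from those not above p; this separates the ends of most pairs of
   edges. *)
have ne u v : p <= u -> ~~ (p <= v) -> u != v.
  by move=> pu; apply: contra => /eqP <-.
have ne' u v : p <= u -> ~~ (p <= v) -> v != u by rewrite eq_sym; apply: ne.
have lt_xa := covers_lt xa; have lt_ae := covers_lt ae.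
have lt_eh := covers_lt eh; have lt_xe := lt_trans lt_xa lt_ae.
have lt_xh := lt_trans lt_xe lt_eh; have lt_ah := lt_trans lt_ae lt_eh.
have lt_ch := covers_lt ch; have lt_bc := covers_lt bc.
have lt_bh := lt_trans lt_bc lt_ch; have lt_xb := covers_lt xb.
have lt_xc := lt_trans lt_xb lt_bc.
have hyp1 : [/\ (pos x).2 < (pos b).2, (pos x).2 < (pos a).2
    & (pos b).2 < (pos c).2]%R by split; apply: pos_up.
have hyp2 : [/\ (pos a).2 < (pos c).2, (pos a).2 < (pos e).2,
    (pos e).2 < (pos h).2 & (pos c).2 < (pos h).2]%R.
  by split; apply: pos_up => //; apply: covers_lt.
have hyp3 : [/\ apart (pos b) (pos c) (pos x) (pos a),
   apart (pos e) (pos h) (pos a) (pos c), apart (pos x) (pos b) (pos a) (pos e)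
   & apart (pos x) (pos b) (pos e) (pos h)].
  by split; apply: edges_apart => //;
    first [exact: ne | exact: ne' | by rewrite lt_eqF | by rewrite gt_eqF].
have hyp4 : apart (pos b) (pos c) (pos a) (pos e).
  by apply: edges_apart => //; exact: ne.
have hyp5 : apart (pos b) (pos c) (pos e) (pos h).
  by apply: edges_apart => //; first [exact: ne | by rewrite lt_eqF].
split=> -[l1 l2].
  exact: (no_left_twist hyp1 hyp2 hyp3 hyp4 hyp5 l1 l2).
exact: (no_right_twist hyp1 hyp2 hyp3 hyp4 hyp5 l1 l2).
Qed.

(** The pair p, q is compared at x and the pair p, r at [x]|[q]. Left or right is decided at both
    places, and [twist_free] excludes a change. *)
Lemma jleft_cover p q r : jirr p -> jirr q -> jirr r ->
  p >< q -> p >< r -> q < r -> (forall s, jirr s -> q < s -> ~~ (s < r)) ->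
  (jleft p q <-> jleft p r).
Proof.
move=> pj qj rj pIq pIr qr cov.
have [x xp xq] := incomparable_addable distD pj qj pIq.
have pq : p != q by apply/eqP => E; rewrite E comparablexx in pIq.
have pr : p != r by apply/eqP => E; rewrite E comparablexx in pIr.
have ar : addable (x `|` q) r by apply: (addable_upper distD slimD xp).
have ap : addable (x `|` q) p by apply: addable_joinr => //; rewrite eq_sym.
have [no1 no2] := twist_free xp xq ar pq pr.
rewrite (jleftE xp xq pq) (jleftE ap ar pr); split=> l1.
  have := left_of_total (covers_add distD ap) (covers_add distD ar) (add_neq ap ar pr).
  by case=> // l2; case: no1.
have := left_of_total (covers_add distD xp) (covers_add distD xq) (add_neq xp xq pq).
by case=> // l2; case: no2.
Qed.

(** Induction on the number of elements between q and r. A join-irreducible strictly between them is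
    again incomparable to p and splits the interval. *)
Lemma jleft_lt p q r : jirr p -> jirr q -> jirr r ->
  p >< q -> p >< r -> q < r -> (jleft p q <-> jleft p r).
Proof.
move=> pj; have [n] := ubnP #|[set s | q < s < r]|.
elim: n q r => // n IH q r le_n qj rj pIq pIr qr.
have [[s /and3P[sj qs sr]] | none] :=
    pselect (exists s, [&& jirr s, q < s & s < r]); last first.
  apply: jleft_cover => // s sj qs; apply/negP => sr.
  by apply: none; exists s; rewrite sj qs.
have pIs : p >< s.
  case: (comparableP p s) => // [ps|sp|E].
  - by case/negP: pIr; rewrite lt_comparable // (lt_trans ps).
  - by case/negP: pIq; rewrite gt_comparable // (lt_trans qs).
  - by case/negP: pIr; rewrite E lt_comparable.
have smaller a b : q <= a -> b <= r -> (s == a) || (s == b) ->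
    (#|[set t | (a < t < b)%O]| < n)%N.
  move=> qa br sab; rewrite -ltnS; apply: leq_trans le_n; rewrite ltnS.
  apply/proper_card/properP; split.
    apply/subsetP=> t; rewrite !inE => /andP[a_t tb].
    by rewrite (le_lt_trans qa a_t) (lt_le_trans tb br).
  exists s; rewrite !inE ?qs //.
  by case/orP: sab => /eqP->; rewrite ltxx ?andbF.
apply: (iff_trans (IH q s _ qj sj pIq pIs qs)).
  by apply: smaller; rewrite ?lexx ?(ltW sr) ?eqxx ?orbT.
by apply: IH => //; apply: smaller; rewrite ?lexx ?(ltW qs) ?eqxx.
Qed.

Lemma jleft_consistent p q r : jirr p -> jirr q -> jirr r ->
  p >< q -> p >< r -> (jleft p q <-> jleft p r).
Proof.
move=> pj qj rj pIq pIr; case: (comparableP q r) => [qr|rq|qIr|->//].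
- exact: jleft_lt.
- by apply: iff_sym; apply: jleft_lt.
have := slim_comparable slimD pj qj rj.
by rewrite (negPf pIq) (negPf pIr) (negPf qIr).
Qed.

Definition right_type p : bool :=
  `[< exists q, [/\ jirr q, p >< q & jleft q p] >].

Definition rightJ : {set D} := [set p | jirr p & right_type p].
(** A join-irreducible comparable to all others counts as left, in accordance with [good], which
    makes the common steps of touching chains left steps. *)
Definition leftJ : {set D} := [set p | jirr p & ~~ right_type p].

Lemma right_typeE p q : jirr p -> jirr q -> p >< q ->
  right_type p <-> jleft q p.
Proof.
move=> pj qj pIq; split=> [/asboolP[r [rj pIr rp]] | qp]; last first.
  by apply/asboolP; exists q.
have [pq|//] := jleft_total pj qj pIq.
by case: (jleft_asym rp); apply/(jleft_consistent pj qj rj pIq pIr).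
Qed.

Lemma type_opposite p q : jirr p -> jirr q -> p >< q ->
  right_type p = ~~ right_type q.
Proof.
move=> pj qj pIq; have qIp : q >< p by rewrite comparable_sym.
have rp := right_typeE pj qj pIq; have rq := right_typeE qj pj qIp.
apply/idP/negP => [/rp qp /rq pq | nrq]; first exact: jleft_asym qp pq.
by have [/rq//|/rp] := jleft_total pj qj pIq.
Qed.

Lemma leftJ_chain : {in leftJ &, forall p q, p >=< q}.
Proof.
move=> p q; rewrite !inE => /andP[pj pl] /andP[qj ql].
by apply/negPn/negP => /(type_opposite pj qj); rewrite (negPf pl) ql.
Qed.

Lemma rightJ_chain : {in rightJ &, forall p q, p >=< q}.
Proof.
move=> p q; rewrite !inE => /andP[pj pl] /andP[qj ql].
by apply/negPn/negP => /(type_opposite pj qj); rewrite pl ql.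
Qed.

End Orientation.

(** * The diagram of a pair of lattice paths *)

Local Open Scope order_scope.

Record dyck := Dyck { dyck_word : word; dyck_good : good 0 dyck_word }.
Coercion dyck_word : dyck >-> list.

Section Staircase.
Variable w : dyck.

Record staircase := Staircase {
  point :> (nat *p nat)%type;
  point_in : region w point
}.

HB.instance Definition _ := [isSub for point].
HB.instance Definition _ := [Countable of staircase by <:].

Definition staircase_code (x : staircase) : 'I_(size w).+1 * 'I_(size w).+1 :=
  (inord (point x).1, inord (point x).2).

Definition staircase_decode (p : 'I_(size w).+1 * 'I_(size w).+1) :
  option staircase := insub ((p.1 : nat, p.2 : nat) : nat *p nat).

Lemma staircase_codeK : pcancel staircase_code staircase_decode.
Proof.
case=> [[i j] rp]; rewrite /staircase_decode /staircase_code /=.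
have [_ _ ij] := region_le_size (dyck_good w) rp.
by rewrite !inordK ?ltnS ?(leq_trans _ ij) ?leq_addr ?leq_addl // insubT.
Qed.

HB.instance Definition _ : isFinite staircase := PCanIsFinite staircase_codeK.

Lemma region_meet_closed : meet_closed (region w : pred (nat *p nat)).
Proof. by move=> [i j] [i' j'] h1 h2; apply: (region_min h1 h2). Qed.

Lemma region_join_closed : join_closed (region w : pred (nat *p nat)).
Proof. by move=> [i j] [i' j'] h1 h2; apply: (region_max h1 h2). Qed.

HB.instance Definition _ :=
  @Order.SubChoice_isSubLattice.Build _ (nat *p nat)%type (region w)
    (Order.Disp tt tt) staircase region_meet_closed region_join_closed.

Definition lc (x : staircase) : nat := (point x).1.
Definition rc (x : staircase) : nat := (point x).2.

Lemma le_staircase (x y : staircase) :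
  (x <= y) = (lc x <= lc y)%N && (rc x <= rc y)%N.
Proof. by []. Qed.

Definition staircase_bot : staircase := @Staircase (0%N, 0%N) (region_bot w).

Definition staircase_top : staircase :=
  @Staircase (lefts w (size w), rights w (size w)) (region_top (dyck_good w)).

Lemma staircase_bot_le x : staircase_bot <= x.
Proof. by []. Qed.

Lemma staircase_top_ge x : x <= staircase_top.
Proof.
case: x => [[i j] rp]; rewrite le_staircase /=.
by have [-> ->] := region_le_size (dyck_good w) rp.
Qed.

HB.instance Definition _ :=
  @Order.hasBottom.Build _ staircase staircase_bot staircase_bot_le.
HB.instance Definition _ :=
  @Order.hasTop.Build _ staircase staircase_top staircase_top_ge.

Implicit Types x y z : staircase.

Lemma lc_meet x y : lc (x `&` y) = minn (lc x) (lc y). Proof. by []. Qed.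
Lemma rc_meet x y : rc (x `&` y) = minn (rc x) (rc y). Proof. by []. Qed.
Lemma lc_join x y : lc (x `|` y) = maxn (lc x) (lc y). Proof. by []. Qed.
Lemma rc_join x y : rc (x `|` y) = maxn (rc x) (rc y). Proof. by []. Qed.

Lemma region_coords x : region w (lc x, rc x).
Proof. by case: x => [[i j]]. Qed.

Lemma point_inj x y :
  lc x = lc y -> rc x = rc y -> x = y.
Proof.
case: x y => [[i j] rx] [[i' j'] ry]; rewrite /lc /rc /= => E1 E2.
by apply: val_inj; rewrite /= E1 E2.
Qed.

Definition staircase_rank x : nat := (lc x + rc x)%N.

Lemma staircase_rank_lt x y : x < y -> (staircase_rank x < staircase_rank y)%N.
Proof.
rewrite lt_neqAle le_staircase /staircase_rank => /andP[/eqP xy /andP[le1 le2]].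
rewrite ltn_neqAle leq_add // andbT; apply/negP => /eqP sE.
by apply: xy; apply: point_inj; lia.
Qed.

Lemma staircase_rank_step x y : x < y -> exists z,
  [/\ x < z, z <= y & staircase_rank z = (staircase_rank x).+1].
Proof.
rewrite lt_neqAle le_staircase => /andP[/eqP xy /andP[le1 le2]].
have [rx ry] := (region_coords x, region_coords y).
have lt_of z : x <= z -> staircase_rank z = (staircase_rank x).+1 -> x < z.
  move=> xz zE; rewrite lt_neqAle xz andbT.
  by apply/eqP => xzE; rewrite xzE in zE; lia.
have ne : (lc x, rc x) != (lc y, rc y).
  by apply/eqP => -[E1 E2]; apply/xy/point_inj.
have /orP[/andP[i1 r1]|/andP[j1 r1]] := region_step (dyck_good w) rx ry le1 le2 ne.
  exists (@Staircase _ r1); split.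
  - apply: lt_of; last by rewrite /staircase_rank /lc /rc /= addSn.
    by rewrite le_staircase /lc /rc /= leqnSn leqnn.
  - by rewrite le_staircase /lc /rc /= i1.
  - by rewrite /staircase_rank /lc /rc /= addSn.
exists (@Staircase _ r1); split.
- apply: lt_of; last by rewrite /staircase_rank /lc /rc /= addnS.
  by rewrite le_staircase /lc /rc /= leqnSn leqnn.
- by rewrite le_staircase /lc /rc /= le1.
- by rewrite /staircase_rank /lc /rc /= addnS.
Qed.

Lemma covers_point x y : covers x y ->
  lc y = (lc x).+1 /\ rc y = rc x \/
  lc y = lc x /\ rc y = (rc x).+1.
Proof.
rewrite (covers_rank staircase_rank_lt staircase_rank_step) /staircase_rank.
case/andP=> /ltW; rewrite le_staircase => /andP[le1 le2] /eqP; lia.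
Qed.

Lemma length_staircase : length staircase = size w.
Proof.
rewrite (length_rank staircase_rank_lt staircase_rank_step) //.
by rewrite /staircase_rank /lc /rc /= sum_size ?dyck_good.
Qed.

Lemma staircase_distributive : distributive staircase.
Proof.
move=> x y z; apply: point_inj; rewrite !(lc_join, lc_meet, rc_join, rc_meet); lia.
Qed.

Lemma staircase_incomparable x y : x >< y ->
  (lc x < lc y /\ rc y < rc x)%N \/
  (lc y < lc x /\ rc x < rc y)%N.
Proof. by rewrite negb_or !le_staircase; lia. Qed.

(** Among three pairwise incomparable points, the one with the middle first coordinate is the join
    of its meets with the other two, so it is not join-irreducible. *)
Lemma staircase_slim : slim staircase.
Proof.
have middle x y z : join_irreducible y ->
    (lc x < lc y -> rc y < rc x ->
     lc y < lc z -> rc z < rc y -> False)%N.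
  move=> jy h1 h2 h3 h4.
  have yE : y = (x `&` y) `|` (y `&` z).
    by apply: point_inj; rewrite !(lc_join, lc_meet, rc_join, rc_meet); lia.
  have [E | E] := jy _ _ yE.
    by have := congr1 lc E; rewrite lc_meet; lia.
  by have := congr1 rc E; rewrite rc_meet; lia.
move=> [x [y [z [[[_ jx] [_ jy] [_ jz]] [xy xz yz]]]]].
have := staircase_incomparable xy; have := staircase_incomparable xz.
have := staircase_incomparable yz.
by case=> -[? ?] [] [? ?] [] [? ?];
  first [exact: (middle x y z) | exact: (middle x z y) | exact: (middle y x z)
  | exact: (middle y z x) | exact: (middle z x y) | exact: (middle z y x) | lia].
Qed.

End Staircase.

(** * Drawing the region by rotating the grid *)

Local Open Scope ring_scope.

(** Used to locate the common point of two grid edges in one coordinate: distinct unit intervals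
    with integer ends share at most an end. *)
Lemma natr_add_unit (R : realType) (i i' : nat) (t t' : R) :
  0 <= t <= 1 -> 0 <= t' <= 1 -> i%:R + t = i'%:R + t' ->
  [\/ i = i' /\ t = t', i' = i.+1 /\ (t = 1 /\ t' = 0)
    | i = i'.+1 /\ (t = 0 /\ t' = 1)].
Proof.
move=> /andP[t0 t1] /andP[t0' t1'] E.
have [lt_ii|lt_ii|ii] := ltngtP i i'.
- have : i.+1%:R <= i'%:R :> R by rewrite ler_nat.
  rewrite -natr1 => le1; constructor 2.
  have iE : i' = i.+1; last by rewrite iE -natr1 in E; split=> //; split; lra.
  apply/eqP; rewrite eqn_leq lt_ii andbT -(ler_nat R) -[i.+1%:R]natr1; lra.
- have : i'.+1%:R <= i%:R :> R by rewrite ler_nat.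
  rewrite -natr1 => le1; constructor 3.
  have iE : i = i'.+1; last by rewrite iE -natr1 in E; split=> //; split; lra.
  apply/eqP; rewrite eqn_leq lt_ii andbT -(ler_nat R) -[i'.+1%:R]natr1; lra.
- by constructor 1; rewrite ii in E; split=> //; lra.
Qed.

Section StaircaseDiagram.
Variables (R : realType) (w : dyck).
Implicit Types x y : staircase w.

(** The grid turned by 45 degrees and scaled: a left step goes up and to the left, a right step up
    and to the right. *)
Definition staircase_pos x : R * R :=
  ((rc x)%:R - (lc x)%:R, (lc x)%:R + (rc x)%:R).

Lemma staircase_pos_inj : injective staircase_pos.
Proof.
move=> x y [E1 E2]; apply: point_inj; apply/eqP; rewrite -(eqr_nat R); apply/eqP;
  lra.
Qed.

Lemma staircase_pos_up x y :
  (x < y)%O -> (staircase_pos x).2 < (staircase_pos y).2.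
Proof. by move/staircase_rank_lt; rewrite /= -!natrD ltr_nat. Qed.

Lemma staircase_edge x y p : covers x y ->
  on_segment (staircase_pos x) (staircase_pos y) p ->
  exists2 t, 0 <= t <= 1 &
    [/\ lc y = (lc x).+1, rc y = rc x,
        p.1 = (rc x)%:R - ((lc x)%:R + t)
      & p.2 = ((lc x)%:R + t) + (rc x)%:R] \/
    [/\ lc y = lc x, rc y = (rc x).+1,
        p.1 = ((rc x)%:R + t) - (lc x)%:R
      & p.2 = (lc x)%:R + ((rc x)%:R + t)].
Proof.
move=> /covers_point xy [t [t01 p1 p2]]; exists t => //.
case: xy => -[E1 E2]; [left | right]; split=> //; rewrite ?p1 ?p2 /= E1 E2 -natr1;
  ring.
Qed.

Lemma staircase_noncrossing x y x' y' :
  covers x y -> covers x' y' -> (x, y) <> (x', y') ->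
  forall p, on_segment (staircase_pos x) (staircase_pos y) p ->
    on_segment (staircase_pos x') (staircase_pos y') p ->
    exists v, [/\ v \in [:: x; y], v \in [:: x'; y'] & p = staircase_pos v].
Proof.
move=> xy xy' ne p /(staircase_edge xy)[t t01 e1] /(staircase_edge xy')[t' t01' e2].
have common u v : u \in [:: x; y] -> v \in [:: x'; y'] ->
    lc u = lc v -> rc u = rc v ->
    p.1 = (rc u)%:R - (lc u)%:R -> p.2 = (lc u)%:R + (rc u)%:R ->
    exists v, [/\ v \in [:: x; y], v \in [:: x'; y'] & p = staircase_pos v].
  move=> uxy vxy lE rE E1 E2; have uv := point_inj lE rE.
  exists u; split=> //; first by rewrite uv.
  by rewrite [p]surjective_pairing E1 E2.
have [inx iny] : x \in [:: x; y] /\ y \in [:: x; y] by rewrite !inE !eqxx orbT.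
have [inx' iny'] : x' \in [:: x'; y'] /\ y' \in [:: x'; y'].
  by rewrite !inE !eqxx orbT.
have natR m n : m%:R = n%:R :> R -> m = n by move/eqP; rewrite eqr_nat => /eqP.
have z01 : 0 <= (0 : R) <= 1 by rewrite lexx ler01.
have same : lc x = lc x' -> rc x = rc x' -> lc y = lc y' -> rc y = rc y' -> False.
  by move=> *; apply: ne; congr pair; apply: point_inj.
clear ne.
have toR m n : m = n.+1 -> m%:R = n%:R + 1 :> R by move=> ->; rewrite natr1.
(* One case for each pair of directions. Parallel edges with a common point lie on one grid line, so
   they coincide, which [same] excludes, or share an end. *)
case: e1 => -[y1 y2 p1 p2]; case: e2 => -[y1' y2' p1' p2'].
- have rE : rc x = rc x' by apply: natR; lra.
  have lE : (lc x)%:R + t = (lc x')%:R + t' by lra.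
  have Y := toR _ _ y1; have Y' := toR _ _ y1'.
  have [[l1 tt]|[l1 [t1 t0]]|[l1 [t0 t1]]] := natr_add_unit t01 t01' lE.
  + by case: same; rewrite ?y1 ?y1' ?y2 ?y2' ?l1 ?rE.
  + by apply: (common y x') => //; [congruence | congruence | rewrite y2; lra | rewrite y2; lra].
  + by apply: (common x y') => //; [congruence | congruence | lra | lra].
(* For perpendicular edges each coordinate of the common point is constant on one edge, hence an
   integer; the summand 0 puts it in the form of [natr_add_unit], and the point is an end of both
   edges. *)
- have E1 : (lc x)%:R + t = (lc x')%:R + 0 by lra.
  have E2 : (rc x)%:R + 0 = (rc x')%:R + t' by lra.
  have Y := toR _ _ y1; have Y' := toR _ _ y2'.
  have [[a1 ta]|[a1 [ta _]]|[_ [_ /esym/eqP]]] := natr_add_unit t01 z01 E1;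
    have [[b1 tb]|[_ [/esym/eqP + _]]|[b1 [_ tb]]] := natr_add_unit z01 t01' E2;
    rewrite ?oner_eq0 //.
  + by apply: (common x x') => //; lra.
  + by apply: (common x y') => //; [congruence | congruence | lra | lra].
  + by apply: (common y x') => //; [congruence | congruence | rewrite y2; lra | rewrite y2; lra].
  + by apply: (common y y') => //; [congruence | congruence | rewrite y2; lra | rewrite y2; lra].
- have E1 : (rc x)%:R + t = (rc x')%:R + 0 by lra.
  have E2 : (lc x)%:R + 0 = (lc x')%:R + t' by lra.
  have Y := toR _ _ y2; have Y' := toR _ _ y1'.
  have [[a1 ta]|[a1 [ta _]]|[_ [_ /esym/eqP]]] := natr_add_unit t01 z01 E1;
    have [[b1 tb]|[_ [/esym/eqP + _]]|[b1 [_ tb]]] := natr_add_unit z01 t01' E2;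
    rewrite ?oner_eq0 //.
  + by apply: (common x x') => //; lra.
  + by apply: (common x y') => //; [congruence | congruence | lra | lra].
  + by apply: (common y x') => //; [congruence | congruence | rewrite y1; lra | rewrite y1; lra].
  + by apply: (common y y') => //; [congruence | congruence | rewrite y1; lra | rewrite y1; lra].
- have lE : lc x = lc x' by apply: natR; lra.
  have rE : (rc x)%:R + t = (rc x')%:R + t' by lra.
  have Y := toR _ _ y2; have Y' := toR _ _ y2'.
  have [[r1 tt]|[r1 [t1 t0]]|[r1 [t0 t1]]] := natr_add_unit t01 t01' rE.
  + by case: same; rewrite ?y1 ?y1' ?y2 ?y2' ?r1 ?lE.
  + by apply: (common y x') => //; [congruence | congruence | rewrite y1; lra | rewrite y1; lra].
  + by apply: (common x y') => //; [congruence | congruence | lra | lra].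
Qed.

Definition staircase_diagram : diagram R :=
  Diagram staircase_pos_inj staircase_pos_up staircase_noncrossing.

Lemma staircase_left_of (x y z : staircase_diagram) :
  covers x y -> covers x z -> left_of x y z <-> (lc z < lc y)%N.
Proof.
move=> xy xz; rewrite /left_of /inv_slope /=.
(* The inverse slope is -1 on left steps and 1 on right steps. *)
have slope v : covers x v -> ((rc v)%:R - (lc v)%:R - ((rc x)%:R - (lc x)%:R)) /
   ((lc v)%:R + (rc v)%:R - ((lc x)%:R + (rc x)%:R)) = 1 - (lc v - lc x)%:R *+ 2 :> R.
  by case/covers_point => -[-> ->]; rewrite ?subSnn ?subnn -natr1
    [X in _ / X](_ : _ = 1) ?divr1; ring.
rewrite !slope // ltrD2l ltrN2 ltr_pMn2r // ltr_nat.
have := covers_point xy; have := covers_point xz; lia.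
Qed.

End StaircaseDiagram.

(** * Sublattices of the grid *)

Local Open Scope order_scope.

Lemma lower_cover (d : Order.disp_t) (L : finTBLatticeType d) (y : L) :
  y != \bot -> exists x, covers x y.
Proof.
move=> y0; have lt0 : \bot < y by rewrite lt_neqAle eq_sym y0 le0x.
case: (@arg_maxnP _ \bot (fun x => x < y) (fun x => #|[set u | u <= x]|) lt0).
move=> x xy maxx; exists x; rewrite /covers xy; apply/forallP=> z.
apply/negP => /andP[xz zy]; have := maxx z zy; apply/negP; rewrite -ltnNge.
apply/proper_card/properP; split.
  by apply/subsetP=> u; rewrite !inE => /le_trans; apply; apply: ltW.
by exists z; rewrite !inE ?lexx // (lt_geF xz).
Qed.

Section ChainCount.
Variables (d : Order.disp_t) (L : finTBLatticeType d) (K : {set L}).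
Hypotheses (distL : distributive L) (chK : {in K &, forall p q, p >=< q}).
Implicit Types x y : L.

Definition count_below x : nat := #|below x :&: K|.

(** Both sets are initial segments of the chain K. Hence their cardinalities determine them, and
    joins and meets become maxima and minima. *)
Lemma below_chain_nested x y :
  (below x :&: K \subset below y :&: K) || (below y :&: K \subset below x :&: K).
Proof.
apply/negPn/negP; rewrite negb_or => /andP[/subsetPn[p px py] /subsetPn[q qy qx]].
move: px py qy qx; rewrite !inE => /andP[/andP[pj px] pK].
rewrite pj pK andbT /= => py /andP[/andP[qj qy] qK].
rewrite qj qK andbT /= => qx.
have /orP[pq|qp] := chK pK qK.
  by rewrite (le_trans pq qy) in py.
by rewrite (le_trans qp px) in qx.
Qed.

Lemma count_below_sub x y :
  (count_below x <= count_below y)%N -> below x :&: K \subset below y :&: K.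
Proof.
have /orP[//|yx] := below_chain_nested x y => le_xy.
by have /eqP-> : below y :&: K == below x :&: K by rewrite eqEcard yx.
Qed.

Lemma count_below_mono x y : x <= y -> (count_below x <= count_below y)%N.
Proof. by rewrite le_below => xy; apply/subset_leq_card/setSI. Qed.

Lemma count_below_join x y :
  count_below (x `|` y) = maxn (count_below x) (count_below y).
Proof.
rewrite /count_below below_join // setIUl.
have /orP[xy|yx] := below_chain_nested x y.
  by rewrite (setUidPr xy); symmetry; apply/maxn_idPr/subset_leq_card.
by rewrite (setUidPl yx); symmetry; apply/maxn_idPl/subset_leq_card.
Qed.

Lemma count_below_meet x y :
  count_below (x `&` y) = minn (count_below x) (count_below y).
Proof.
rewrite /count_below below_meet setIIl.
have /orP[xy|yx] := below_chain_nested x y.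
  by rewrite (setIidPl xy); symmetry; apply/minn_idPl/subset_leq_card.
by rewrite (setIidPr yx); symmetry; apply/minn_idPr/subset_leq_card.
Qed.

End ChainCount.

(** * A ranked sublattice of the grid is the region of a word *)

Section SublatticeOfGrid.
Variables (d : Order.disp_t) (L : finTBLatticeType d) (c1 c2 : L -> nat).
Implicit Types x y z : L.
Let rk x := (c1 x + c2 x)%N.
Hypothesis c_le : forall x y, x <= y = (c1 x <= c1 y)%N && (c2 x <= c2 y)%N.
Hypothesis c_join1 : forall x y, c1 (x `|` y) = maxn (c1 x) (c1 y).
Hypothesis c_join2 : forall x y, c2 (x `|` y) = maxn (c2 x) (c2 y).
Hypothesis c_meet1 : forall x y, c1 (x `&` y) = minn (c1 x) (c1 y).
Hypothesis c_meet2 : forall x y, c2 (x `&` y) = minn (c2 x) (c2 y).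
Hypothesis c_bot : rk \bot = 0%N.
Hypothesis c_step : forall x y, x < y ->
  exists z, [/\ x < z, z <= y & rk z = (rk x).+1].
Hypothesis c_ground : forall x, x != \top -> (forall z, x >=< z) ->
  exists2 y, x < y & c1 y = (c1 x).+1 /\ c2 y = c2 x.

Lemma coords_inj x y : c1 x = c1 y -> c2 x = c2 y -> x = y.
Proof. by move=> E1 E2; apply/le_anti; rewrite !c_le E1 E2 !leqnn. Qed.

Lemma rank_between x y k : x <= y -> (rk x <= k <= rk y)%N ->
  exists z, [/\ x <= z, z <= y & rk z = k].
Proof.
move=> xy; elim: k => [|k IH] /andP[xk ky].
  by exists x; split=> //; lia.
move: xk; rewrite leq_eqVlt => /orP[/eqP xk|]; first by exists x.
rewrite ltnS => xk; have [|z [xz zy zk]] := IH; first by rewrite xk ltnW.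
have lt_zy : z < y.
  by rewrite lt_neqAle zy andbT; apply/eqP => E; rewrite -zk E ltnn in ky.
have [u [zu uy uk]] := c_step lt_zy.
by exists u; split=> //; [apply: le_trans xz (ltW zu) | rewrite uk zk].
Qed.

Definition height : nat := rk \top.
(** The left boundary of the image on level k; [max2] gives the right boundary in the same way. *)
Definition max1 k : nat := \max_(x | rk x == k) c1 x.
Definition max2 k : nat := \max_(x | rk x == k) c2 x.

Lemma rk_le x y : x <= y -> (rk x <= rk y)%N.
Proof. by rewrite c_le /rk; lia. Qed.

Lemma rk_height x : (rk x <= height)%N.
Proof. exact/rk_le/lex1. Qed.

Lemma le_max1 x : (c1 x <= max1 (rk x))%N.
Proof. exact: (@leq_bigmax_cond _ (fun y => rk y == rk x) c1). Qed.

Lemma le_max2 x : (c2 x <= max2 (rk x))%N.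
Proof. exact: (@leq_bigmax_cond _ (fun y => rk y == rk x) c2). Qed.

Lemma level_nonempty k : (k <= height)%N -> exists x, rk x = k.
Proof.
move=> kh; have [|x [_ _ xk]] := @rank_between \bot \top k (le0x _).
  by rewrite c_bot.
by exists x.
Qed.

Lemma max1_attained k : (k <= height)%N -> exists2 x, rk x = k & c1 x = max1 k.
Proof.
move=> /level_nonempty[x xk]; rewrite /max1.
have [|y /eqP yk ->] := @eq_bigmax_cond _ (fun y => rk y == k) c1; last by exists y.
by apply/card_gt0P; exists x; apply/eqP.
Qed.

Lemma max2_attained k : (k <= height)%N -> exists2 x, rk x = k & c2 x = max2 k.
Proof.
move=> /level_nonempty[x xk]; rewrite /max2.
have [|y /eqP yk ->] := @eq_bigmax_cond _ (fun y => rk y == k) c2; last by exists y.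
by apply/card_gt0P; exists x; apply/eqP.
Qed.

Lemma max1_step k : (k < height)%N -> (max1 k <= max1 k.+1 <= (max1 k).+1)%N.
Proof.
move=> kh; apply/andP; split.
  have [x xk <-] := max1_attained (ltnW kh).
  have [|y [xy _ yk]] := @rank_between x \top k.+1 (lex1 _).
    by rewrite xk leqnSn.
  by rewrite -yk; apply: leq_trans (le_max1 y); move: xy; rewrite c_le => /andP[].
have [y yk <-] := max1_attained kh.
have [|x [_ xy xk]] := @rank_between \bot y k (le0x _).
  by rewrite c_bot yk leqnSn.
have := le_max1 x; move: xy xk yk; rewrite c_le /rk => /andP[h1 h2] xk yk.
by rewrite xk; lia.
Qed.

Lemma max2_step k : (k < height)%N -> (max2 k <= max2 k.+1 <= (max2 k).+1)%N.
Proof.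
move=> kh; apply/andP; split.
  have [x xk <-] := max2_attained (ltnW kh).
  have [|y [xy _ yk]] := @rank_between x \top k.+1 (lex1 _).
    by rewrite xk leqnSn.
  by rewrite -yk; apply: leq_trans (le_max2 y); move: xy; rewrite c_le => /andP[].
have [y yk <-] := max2_attained kh.
have [|x [_ xy xk]] := @rank_between \bot y k (le0x _).
  by rewrite c_bot yk leqnSn.
have := le_max2 x; move: xy xk yk; rewrite c_le /rk => /andP[h1 h2] xk yk.
by rewrite xk; lia.
Qed.

Lemma max_sum k : (k <= height)%N -> (k <= max1 k + max2 k)%N.
Proof.
by move=> /level_nonempty[x <-]; apply: leq_add; [apply: le_max1 | apply: le_max2].
Qed.

Lemma max_height : max1 height = c1 \top /\ max2 height = c2 \top.
Proof.
have top x : rk x = height -> x = \top.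
  move=> E; have := lex1 x; rewrite c_le; move: E; rewrite /height /rk => E le.
  by apply: coords_inj; lia.
have [x /top-> <-] := max1_attained (leqnn height).
by have [y /top-> <-] := max2_attained (leqnn height).
Qed.

(** Where the boundaries meet, level k has a single element x. Every other element reaches level k
    by unit steps, hence passes through x and is comparable to it, and [c_ground] supplies a left
    step from x. *)
Lemma max1_tight k : (k < height)%N -> (max1 k + max2 k = k)%N ->
  max1 k.+1 = (max1 k).+1.
Proof.
move=> kh tight; have [x xk x1] := max1_attained (ltnW kh).
have x2 : c2 x = max2 k by move: xk tight; rewrite /rk; lia.
have only u : rk u = k -> u = x.
  move=> uk; have := le_max1 u; have := le_max2 u; rewrite uk => u2 u1.
  by apply: coords_inj; move: uk xk; rewrite /rk; lia.
have cmp z : x >=< z.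
  have [zk|kz] := leqP (rk z) k.
    have [|u [zu _ /only uE]] := @rank_between z \top k (lex1 _).
      by rewrite zk; apply: ltnW kh.
    by rewrite uE in zu; apply: ge_comparable.
  have [|u [_ uz /only uE]] := @rank_between \bot z k (le0x _).
    by rewrite c_bot (ltnW kz).
  by rewrite uE in uz; apply: le_comparable.
have xt : x != \top by apply/eqP => E; move: kh; rewrite -xk E /height ltnn.
have [y _ [y1 y2]] := c_ground xt cmp.
have yk : rk y = k.+1 by rewrite -xk /rk y1 y2 addSn.
have := le_max1 y; have := max1_step kh; rewrite yk y1 x1; lia.
Qed.

(** The left boundary turns left when [max1] grows; the right boundary turns left when [max2] does
    not. *)
Definition boundary_word : word :=
  mkseq (fun k => (max1 k != max1 k.+1, max2 k == max2 k.+1)) height.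

Lemma size_boundary_word : size boundary_word = height.
Proof. exact: size_mkseq. Qed.

Lemma max_bot : max1 0 = 0%N /\ max2 0 = 0%N.
Proof.
have [x xk <-] := max1_attained (leq0n height).
have [y yk <-] := max2_attained (leq0n height).
by move: xk yk; rewrite /rk; lia.
Qed.

Lemma lefts_boundary_word k : (k <= height)%N -> lefts boundary_word k = max1 k.
Proof.
elim: k => [|k IH] kh; first by rewrite lefts0 max_bot.1.
rewrite leftsS ?size_boundary_word //.
rewrite nth_mkseq // (IH (ltnW kh)) [(_, _).1]/=.
by move: (max1_step kh); case: eqP; lia.
Qed.

Lemma rights_boundary_word k : (k <= height)%N -> rights boundary_word k = max2 k.
Proof.
elim: k => [|k IH] kh; first by rewrite rights0 max_bot.2.
rewrite rightsS ?size_boundary_word //.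
rewrite nth_mkseq // (IH (ltnW kh)) [(_, _).2]/=.
by move: (max2_step kh); case: eqP; lia.
Qed.

Lemma good_boundary_word : good 0 boundary_word.
Proof.
apply/goodP; rewrite size_boundary_word; split.
- move=> k kh; rewrite lefts_boundary_word ?rights_boundary_word ?(ltnW kh) //.
  exact/max_sum/ltnW.
- move=> k kh; rewrite lefts_boundary_word ?rights_boundary_word ?(ltnW kh) //.
  move/(max1_tight kh) => E; rewrite nth_mkseq //= E.
  by rewrite neq_ltn ltnSn.
- rewrite lefts_boundary_word ?rights_boundary_word //.
  by case: max_height => -> ->.
Qed.

Lemma region_boundary_word (p : nat * nat) :
  region boundary_word p <-> exists x, p = (c1 x, c2 x).
Proof.
split=> [|[x ->]]; last first.
  rewrite /region /= -/(rk x) lefts_boundary_word ?rights_boundary_word ?rk_height //.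
  by rewrite le_max1 le_max2.
case: p => i j rij; have [_ _] := region_le_size good_boundary_word rij.
rewrite size_boundary_word; move: rij; rewrite /region /=.
move=> /[swap] kh; rewrite lefts_boundary_word ?rights_boundary_word //.
move=> /andP[ile jle].
have [x xk x1] := max1_attained kh; have [y yk y2] := max2_attained kh.
have [m1 m2] := (c_meet1 x y, c_meet2 x y); rewrite /rk in xk yk.
(* With x leftmost and y rightmost on the level [i + j], their meet has coordinates [(c1 y, c2 x)].
   The ranks are chosen so that z is at [(i, c2 x)] and t at [(c1 y, j)]; their join is the required
   point. *)
have [|z [mz zx zk]] := @rank_between (x `&` y) x (i + c2 x) (leIl _ _).
  by rewrite /rk; lia.
have [|t [mt ty tk]] := @rank_between (x `&` y) y (c1 y + j) (leIr _ _).
  by rewrite /rk; lia.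
move: mz zx mt ty zk tk; rewrite !c_le /rk => /andP[? ?] /andP[? ?] /andP[? ?] /andP[? ?] zk tk.
by exists (z `|` t); rewrite c_join1 c_join2; congr pair; lia.
Qed.

End SublatticeOfGrid.

(** * Coordinates of a diagram *)

Local Open Scope order_scope.

Section Coordinatized.
Variable R : realType.
Implicit Types D E : diagram R.

(** The link between diagrams and words: such coordinates pass along similarity maps, exist on every
    slim distributive diagram, and determine the word among the good words of a given length. *)
Definition coordinatized D (w : word) (c1 c2 : D -> nat) : Prop :=
  [/\ forall x y, x <= y = (c1 x <= c1 y)%N && (c2 x <= c2 y)%N,
      forall p, region w p <-> exists x, p = (c1 x, c2 x)
    & forall x y z, covers x y -> covers x z ->
        left_of x y z <-> (c1 z < c1 y)%N].

Lemma staircase_coordinatized (w : dyck) :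
  @coordinatized (staircase_diagram R w) w (@lc w) (@rc w).
Proof.
split=> [// | p | x y z]; last exact: staircase_left_of.
split=> [rp | [x ->]]; last exact: region_coords.
by exists (@Staircase w p rp); case: p rp.
Qed.

Lemma coordinatized_pullback D E (f : D -> E) w (c1 c2 : E -> nat) :
  similarity_map f -> coordinatized w c1 c2 ->
  coordinatized w (c1 \o f) (c2 \o f).
Proof.
move=> [bf fI fU fl] [cle creg cl]; have [g fK gK] := bf.
split=> [x y | p | x y z xy xz] /=.
- by rewrite -cle !leEmeet -fI (can_eq fK).
- rewrite creg; split=> -[x ->]; last by exists (f x).
  by exists (g x); rewrite gK.
- by rewrite (fl x y z xy xz); apply: cl; rewrite similarity_covers.
Qed.

(** Elements with equal coordinates are matched; both order and left-right position are read off
    from the coordinates. *)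
Lemma coordinatized_similar D E w (c1 c2 : D -> nat) (e1 e2 : E -> nat) :
  coordinatized w c1 c2 -> coordinatized w e1 e2 -> similar_diagrams D E.
Proof.
move=> [cle creg cl] [ele ereg el].
have [f fE] : {f : D -> E & forall x, (e1 (f x), e2 (f x)) = (c1 x, c2 x)}.
  apply: (@choice _ _ (fun x y => (e1 y, e2 y) = (c1 x, c2 x))) => x.
  have /ereg[y yE] : region w (c1 x, c2 x) by apply/creg; exists x.
  by exists y.
have [g gE] : {g : E -> D & forall y, (c1 (g y), c2 (g y)) = (e1 y, e2 y)}.
  apply: (@choice _ _ (fun y x => (c1 x, c2 x) = (e1 y, e2 y))) => y.
  have /creg[x xE] : region w (e1 y, e2 y) by apply/ereg; exists y.
  by exists x.
have f1 x : e1 (f x) = c1 x by case: (fE x).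
have f2 x : e2 (f x) = c2 x by case: (fE x).
have g1 y : c1 (g y) = e1 y by case: (gE y).
have g2 y : c2 (g y) = e2 y by case: (gE y).
have f_le x y : (f x <= f y) = (x <= y) by rewrite ele cle !f1 !f2.
have fK : cancel f g by move=> x; apply/le_anti; rewrite !cle g1 g2 f1 f2 !leqnn.
have gK : cancel g f by move=> y; apply/le_anti; rewrite !ele f1 f2 g1 g2 !leqnn.
have bf : bijective f by exists g.
have fI : Order.meet_morphism f.
  move=> x y; apply/le_anti; rewrite lexI !f_le leIl leIr /=.
  by rewrite -[f x `&` f y]gK f_le lexI -!f_le gK leIl leIr.
exists f; split=> // [x y | x y z xy xz].
  apply/le_anti; rewrite leUx !f_le leUl leUr /= andbT.
  by rewrite -[f x `|` f y]gK f_le leUx -!f_le gK leUl leUr.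
rewrite (cl _ _ _ xy xz) -!f1; apply: iff_sym.
by apply: el; rewrite similarity_covers.
Qed.

Lemma coordinatized_inj D w (c1 c2 : D -> nat) x y : coordinatized w c1 c2 ->
  c1 x = c1 y -> c2 x = c2 y -> x = y.
Proof. by move=> [cle _ _] E1 E2; apply/le_anti; rewrite !cle E1 E2 !leqnn. Qed.

(** Covers are the unit steps, since [region_step] puts a point of the region inside any longer
    one. *)
Lemma coordinatized_covers D w (c1 c2 : D -> nat) x y :
  good 0 w -> coordinatized w c1 c2 ->
  covers x y <-> c1 y = (c1 x).+1 /\ c2 y = c2 x \/ c1 y = c1 x /\ c2 y = (c2 x).+1.
Proof.
move=> gw cc; have [cle creg _] := cc; have lt_c u v : u < v ->
    [&& (c1 u <= c1 v)%N, (c2 u <= c2 v)%N & (c1 u + c2 u < c1 v + c2 v)%N].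
  move=> uv; have := ltW uv; rewrite cle => /andP[le1 le2]; rewrite le1 le2 /=.
  rewrite ltnNge; apply/negP => le; move: uv; rewrite lt_neqAle => /andP[/eqP + _].
  by apply; apply: (coordinatized_inj cc); lia.
split=> [xy | xy]; last first.
  have le_xy : x <= y by rewrite cle; lia.
  have lt_xy : x < y.
    by rewrite lt_neqAle le_xy andbT; apply/eqP => E; rewrite E in xy; lia.
  rewrite /covers lt_xy; apply/forallP=> z; apply/negP => /andP[/lt_c xz /lt_c zy].
  by lia.
have /and3P[le1 le2 lt12] := lt_c _ _ (covers_lt xy).
have rx : region w (c1 x, c2 x) by apply/creg; exists x.
have ry : region w (c1 y, c2 y) by apply/creg; exists y.
have ne : (c1 x, c2 x) != (c1 y, c2 y) by rewrite xpair_eqE; lia.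
have [/andP[h /creg[z [z1 z2]]]|/andP[h /creg[z [z1 z2]]]] :=
  orP (region_step gw rx ry le1 le2 ne).
- have zy : z = y.
    apply: (covers_eq xy); last by rewrite cle -z1 -z2; lia.
    rewrite lt_neqAle cle; apply/andP; split; last by lia.
    by apply/eqP => E; rewrite -E in z1; lia.
  by left; rewrite -zy.
- have zy : z = y.
    apply: (covers_eq xy); last by rewrite cle -z1 -z2; lia.
    rewrite lt_neqAle cle; apply/andP; split; last by lia.
    by apply/eqP => E; rewrite -E in z2; lia.
  by right; rewrite -zy.
Qed.

(** * A diagram determines its coordinates *)

Section Unique.
Variable D : diagram R.

Lemma coordinatized_no_swap w w' (c1 c2 e1 e2 : D -> nat) (x y : D) :
  good 0 w -> good 0 w' -> coordinatized w c1 c2 -> coordinatized w' e1 e2 ->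
  (forall z, (c1 z + c2 z <= c1 x + c2 x)%N -> c1 z = e1 z /\ c2 z = e2 z) ->
  (forall z, (e1 z + e2 z <= c1 x + c2 x)%N -> c1 z = e1 z /\ c2 z = e2 z) ->
  c1 y = (c1 x).+1 -> c2 y = c2 x -> e1 y = e1 x -> e2 y = (e2 x).+1 -> False.
Proof.
move=> gw gw' cc ee agc age y1 y2 y1' y2'.
have [cle creg cl] := cc; have [ele ereg el] := ee.
have [x1 x2] := agc x (leqnn _).
have rx : region w' (e1 x, e2 x) by apply/ereg; exists x.
have ry : region w' (e1 x, (e2 x).+1) by apply/ereg; exists y; rewrite y1' y2'.
have [/ereg[z [z1 z2]] | [j jE /ereg[z [z1 z2]]] | [i iE /ereg[z [z1 z2]]]] :=
  region_level gw' rx ry.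
- have xy : covers x y by apply/(coordinatized_covers _ _ gw' ee); right.
  have xz : covers x z by apply/(coordinatized_covers _ _ gw' ee); left.
  have [[t1 t2]|[t1 t2]] := (coordinatized_covers x z gw cc).1 xz.
    have yz : y = z by apply: (coordinatized_inj cc); lia.
    by rewrite -yz in z1; lia.
  have /(cl _ _ _ xy xz)/(el _ _ _ xy xz) : (c1 z < c1 y)%N by lia.
  by lia.
- have [t1 t2] : c1 z = e1 z /\ c2 z = e2 z by apply: age; lia.
  have : z <= y by rewrite cle; lia.
  by rewrite ele; lia.
- have [t1 t2] : c1 z = e1 z /\ c2 z = e2 z by apply: age; lia.
  have : z <= y by rewrite ele; lia.
  by rewrite cle; lia.
Qed.

Lemma coordinatized_bot w (c1 c2 : D -> nat) : coordinatized w c1 c2 ->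
  c1 \bot = 0%N /\ c2 \bot = 0%N.
Proof.
move=> [cle creg _]; have /creg[x [x1 x2]] := region_bot w.
by have := le0x x; rewrite cle -x1 -x2; lia.
Qed.

Lemma coordinatized_agree w w' (c1 c2 e1 e2 : D -> nat) x :
  good 0 w -> good 0 w' -> coordinatized w c1 c2 -> coordinatized w' e1 e2 ->
  c1 x = e1 x /\ c2 x = e2 x.
Proof.
move=> gw gw' cc ee.
suff H n : forall v v' (a1 a2 b1 b2 : D -> nat), good 0 v -> good 0 v' ->
    coordinatized v a1 a2 -> coordinatized v' b1 b2 ->
    forall x, (a1 x + a2 x <= n)%N -> a1 x = b1 x /\ a2 x = b2 x.
  exact: H gw gw' cc ee x (leqnn _).
elim: n => [|n IH] v v' a1 a2 b1 b2 gv gv' aa bb y le_y.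
  have [a01 a02] := coordinatized_bot aa; have [b01 b02] := coordinatized_bot bb.
  have -> : y = \bot by apply: (coordinatized_inj aa); lia.
  by rewrite a01 a02 b01 b02.
have agA : forall z, (a1 z + a2 z <= n)%N -> a1 z = b1 z /\ a2 z = b2 z.
  exact: (IH v v').
have agB : forall z, (b1 z + b2 z <= n)%N -> a1 z = b1 z /\ a2 z = b2 z.
  by move=> z /(IH _ _ _ _ _ _ gv' gv bb aa)[-> ->].
have [->|/lower_cover[u uy]] := eqVneq y \bot.
  have [a01 a02] := coordinatized_bot aa; have [b01 b02] := coordinatized_bot bb.
  by rewrite a01 a02 b01 b02.
have ya := (coordinatized_covers u y gv aa).1 uy.
have yb := (coordinatized_covers u y gv' bb).1 uy.
have [u1 u2] : a1 u = b1 u /\ a2 u = b2 u by apply: agA; lia.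
case: ya => -[ya1 ya2]; case: yb => -[yb1 yb2]; try by lia.
- by case: (coordinatized_no_swap gv gv' aa bb (x := u) (y := y)) => // z le_z;
    [apply: agA | apply: agB]; lia.
- case: (coordinatized_no_swap gv' gv bb aa (x := u) (y := y)) => // z le_z.
    by case: (agB z); lia.
  by case: (agA z); lia.
Qed.

Lemma coordinatized_word_inj w w' (c1 c2 e1 e2 : D -> nat) :
  good 0 w -> good 0 w' -> size w = size w' ->
  coordinatized w c1 c2 -> coordinatized w' e1 e2 -> w = w'.
Proof.
move=> gw gw' sw cc ee; apply: region_inj => // p.
have [_ creg _] := cc; have [_ ereg _] := ee.
have ag x := coordinatized_agree x gw gw' cc ee.
apply/idP/idP => [/creg | /ereg] [x ->]; have [E1 E2] := ag x.
  by apply/ereg; exists x; rewrite E1 E2.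
by apply/creg; exists x; rewrite E1 E2.
Qed.

End Unique.

Section Existence.
Variable D : diagram R.
Hypotheses (distD : distributive D) (slimD : slim D).
Implicit Types x y z p q : D.

Let c1 x := count_below (leftJ D) x.
Let c2 x := count_below (rightJ D) x.

Lemma type_coords_sum x : (c1 x + c2 x)%N = #|below x|.
Proof.
rewrite /c1 /c2 /count_below -cardsUI [X in (_ + X)%N](_ : _ = 0%N) ?addn0.
  congr #|pred_of_set _|; apply/setP=> p; rewrite !inE.
  by case: (jirr p) (p <= x) (right_type p) => [] [] [].
apply/eqP; rewrite cards_eq0; apply/eqP/setP=> p; rewrite !inE.
by case: (jirr p) (p <= x) (right_type p) => [] [] [].
Qed.

Lemma type_coords_le x y : (x <= y) = (c1 x <= c1 y)%N && (c2 x <= c2 y)%N.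
Proof.
apply/idP/andP => [xy | [le1 le2]]; first by split; apply: count_below_mono.
have /subsetP s1 := count_below_sub (leftJ_chain distD slimD) le1.
have /subsetP s2 := count_below_sub (rightJ_chain distD slimD) le2.
rewrite le_below; apply/subsetP=> p px; have [pj _] := andP (etrans (esym (in_below x p)) px).
case: (boolP (right_type p)) => pr.
  by have := s2 p; rewrite inE px !inE pj pr => /(_ isT)/andP[].
by have := s1 p; rewrite inE px !inE pj pr => /(_ isT)/andP[].
Qed.

Lemma count_below_add (K : {set D}) x p : addable x p ->
  count_below K (x `|` p) = (count_below K x + (p \in K))%N.
Proof.
move=> pa; rewrite /count_below below_add // setIUl.
have pnx : p \notin below x by case: pa => _ px _; rewrite in_below negb_and px orbT.
case: (boolP (p \in K)) => pK.
  have /setIidPl-> : [set p] \subset K by rewrite sub1set.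
  by rewrite cardsU1 inE (negPf pnx) addn1.
suff -> : [set p] :&: K = set0 by rewrite set0U addn0.
by apply/setP=> q; rewrite !inE; case: eqP => // ->; rewrite (negPf pK).
Qed.

Lemma type_coords_ground x : x != \top -> (forall z, x >=< z) ->
  exists2 y, x < y & c1 y = (c1 x).+1 /\ c2 y = c2 x.
Proof.
move=> xt cmp.
suff [p pa pl] : exists2 p, addable x p & ~~ right_type p.
  exists (x `|` p); first exact/covers_lt/covers_add.
  have [pj _ _] := pa.
  by rewrite /c1 /c2 !count_below_add // !inE pj pl (negPf pl) addn1 addn0.
have [p pa _] : exists2 p, addable x p & p <= \top.
  by apply: lt_addable => //; rewrite lt_neqAle xt lex1.
case: (boolP (right_type p)) => [pr|pl]; last by exists p.
have [pj px _] := pa; have /asboolP[q [qj pIq _]] := pr.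
have xp : x <= p by have /orP[//|] := cmp p; rewrite (negPf px).
have xq : x < q.
  rewrite lt_neqAle; have /orP[xq|qx] := cmp q.
    by rewrite xq andbT; apply: contra pIq => /eqP <-; apply: ge_comparable.
  by case/negP: pIq; apply: ge_comparable; apply: le_trans qx xp.
have [r ra rq] := lt_addable xq.
have pr' : p != r by apply: contra pIq => /eqP ->; apply: le_comparable.
have pIr := addable_incomparable pa ra pr'; have [rj _ _] := ra.
by exists r => //; rewrite -(type_opposite distD slimD pj rj pIr).
Qed.

Lemma type_coords_left x y z : covers x y -> covers x z ->
  left_of x y z <-> (c1 z < c1 y)%N.
Proof.
move=> /(covers_addable distD)[p pa ->] /(covers_addable distD)[q qa ->].
have [pj _ _] := pa; have [qj _ _] := qa.
rewrite /c1 !count_below_add // !inE pj qj /= ltn_add2l.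
have [->|pq] := eqVneq p q; first by rewrite /left_of ltxx ltnn; split.
have pIq := addable_incomparable pa qa pq.
rewrite -(jleftE slimD pa qa pq).
have qIp : q >< p by rewrite comparable_sym.
rewrite -(right_typeE distD slimD qj pj qIp).
by rewrite (type_opposite distD slimD pj qj pIq); case: (right_type q).
Qed.

Lemma slim_distributive_coordinatized : exists w, exists c1 c2 : D -> nat,
  [/\ good 0 w, size w = length D & coordinatized w c1 c2].
Proof.
have c_bot : (c1 \bot + c2 \bot = 0)%N by rewrite type_coords_sum below_bot cards0.
have c_step x y : x < y -> exists z,
    [/\ x < z, z <= y & (c1 z + c2 z = (c1 x + c2 x).+1)%N].
  by move=> /(card_below_step distD)[z zP]; exists z; rewrite !type_coords_sum.
have j1 := count_below_join distD (leftJ_chain distD slimD).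
have j2 := count_below_join distD (rightJ_chain distD slimD).
have m1 := count_below_meet (leftJ_chain distD slimD).
have m2 := count_below_meet (rightJ_chain distD slimD).
exists (boundary_word c1 c2), c1, c2; split.
- exact: (good_boundary_word type_coords_le c_bot c_step type_coords_ground).
- rewrite size_boundary_word /height type_coords_sum.
  by rewrite (length_card_below distD).
- split; [exact: type_coords_le | | exact: type_coords_left].
  exact: (region_boundary_word type_coords_le j1 j2 m1 m2 c_bot c_step type_coords_ground).
Qed.

End Existence.

End Coordinatized.

Theorem proposition3p4 (R : realType) (h : nat) :
  number_of_classes (@similar_diagrams R)
    (@slim_distributive_of_length R h) (catalan h).
Proof.
rewrite -size_words_catalan.
have wP (i : 'I_(size (words h 0))) : nth [::] (words h 0) i \in words h 0.
  exact: mem_nth.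
have gP (i : 'I_(size (words h 0))) : good 0 (nth [::] (words h 0) i).
  by have := wP i; rewrite mem_words => /andP[].
have sP (i : 'I_(size (words h 0))) : size (nth [::] (words h 0) i) = h.
  by have := wP i; rewrite mem_words => /andP[/eqP].
pose D i := staircase_diagram R (Dyck (gP i)).
have DP i := staircase_coordinatized R (Dyck (gP i)).
exists (fun i => similar_diagrams (D i)); split.
  move=> i j E; apply/val_inj/eqP.
  rewrite -(nth_uniq [::] (ltn_ord i) (ltn_ord j) (uniq_words h 0)).
  have [f sf] : similar_diagrams (D i) (D j) by rewrite E; apply: similar_diagrams_refl.
  apply/eqP; apply: (coordinatized_word_inj (gP i) (gP j) _ (DP i)).
    by rewrite !sP.
  exact: coordinatized_pullback sf (DP j).
move=> C; split=> [[i ->] | [E [[slimE distE lenE] ->]]].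
  exists (D i); split=> //; split.
  - exact: staircase_slim.
  - exact: staircase_distributive.
  - by rewrite length_staircase /= sP.
have [w [c1 [c2 [gw sw cc]]]] := slim_distributive_coordinatized distE slimE.
have ww : w \in words h 0 by rewrite mem_words sw lenE eqxx.
have iw : (index w (words h 0) < size (words h 0))%N by rewrite index_mem.
exists (Ordinal iw); set i := Ordinal iw.
have DE : similar_diagrams (D i) E.
  by apply: coordinatized_similar (DP i) _; rewrite /= nth_index //; exact: cc.
apply/funext => F; apply/propext; split=> [EF|DF].
  exact: similar_diagrams_trans DE EF.
exact: similar_diagrams_trans (similar_diagrams_sym DE) DF.
Qed.
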